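(* In the min-max time-to-reach-$E$ game defined in the context, there is a Focal Line (FL) given by $$\mathcal F=\{(r,\theta)\mid 0<r\le\mu,\ \theta=\pi\},$$ on which $L$'s equilibrium control keeps the state of the system on the line $\theta=\pi$ (i.e. she chooses the heading $\psi$ such that $\dot\theta=0$): $$\sin\psi_{FL}=\frac{r}{\mu},$$ and $M$'s equilibrium control is $\omega_{FL}=1$.
   Context: The Lady $L$ swims with speed $\mu$ in a circular lake of radius $1$; the Man $M$ moves with maximum speed $1$ along the perimeter. The state is $(r,\theta)$, where $r\in[0,1]$ is $L$'s distance from the center and $\theta$ is the angle of $L$ relative to $M$; by reflection symmetry $\theta$ is taken in $[0,\pi]$ without loss of generality. The dynamics are $$\dot r=\mu\cos\psi,\qquad \dot\theta=\frac{\mu}{r}\sin\psi-\omega,$$ with $L$ controlling $\psi\in[-\pi,\pi]$ and $M$ controlling $\omega\in[-1,1]$. Throughout $\mu_{\rm crit}<\mu<1$, where $\mu_{\rm crit}\approx0.21723$ is the value of $\mu$ at which $\pi-\sqrt{1/\mu^2-1}+\cos^{-1}\mu$ vanishes. The game is played below the barrier curve $B(r)=\pi-\sqrt{r^2/\mu^2-1}+\cos^{-1}(\mu/r)$, $r\in[\mu,1]$, i.e. on states with $\theta<B(r)$ whenever $r>\mu$. $L$ minimizes and $M$ maximizes the time for the state to reach the antipodal point $E=(\mu,\pi)$; equilibrium means saddle point of this zero-sum differential game. On $\theta=\pi$, $L$ is allowed to know $M$'s instantaneous control; by symmetry of the line $\theta=\pi$, the choice between $\omega=1$ and $\omega=-1$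 there is made as $\omega=1$ without loss of generality. A Focal Line is a line in the state space which is itself an equilibrium trajectory and has tributary equilibrium trajectories that enter it tangentially. *)

(* Defs.v *)
(* World: Stdlib reals and Coquelicot. *)
From Stdlib Require Export Reals List.
From Coquelicot Require Export Coquelicot.
Open Scope R_scope.

(** A state is a pair (r, theta).  The angle is a real number understood modulo
    2 PI: the game is set up on the full circle, before the reduction to
    [0, PI] by reflection, so that crossing theta = PI needs no special rule. *)
Definition state : Type := (R * R)%type.

Definition critical_speed (m : R) : Prop :=
  0 < m < 1 /\ PI - sqrt (1 / m ^ 2 - 1) + acos m = 0.

Definition barrier (mu r : R) : R :=
  PI - sqrt (r ^ 2 / mu ^ 2 - 1) + acos (mu / r).

(** [acos (cos theta)] is the representative in [0, PI] of theta modulo 2 PI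
    and reflection. *)
Definition in_game (mu : R) (x : state) : Prop :=
  0 <= fst x <= 1 /\
  (mu < fst x -> acos (cos (snd x)) < barrier mu (fst x)).

Definition antipodal (theta : R) : Prop := cos theta = -1.

Definition at_E (mu : R) (x : state) : Prop := fst x = mu /\ antipodal (snd x).

Definition r_rate (mu psi : R) : R := mu * cos psi.
Definition theta_rate (mu r psi omega : R) : R := mu / r * sin psi - omega.

Definition continuous_on_upto (T : R) (f : R -> R) (t : R) : Prop :=
  filterlim f (within (fun s => 0 <= s <= T) (locally t)) (locally (f t)).

(** The dynamics hold off a finite set of times, where the controls may switch.
    L may swim through the center, where theta is undefined: such times are
    among the exceptional ones, and theta may jump there and only there. *)
Definition motion (mu T : R) (x : R -> state) (psi omega : R -> R) : Prop :=
  0 <= T /\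
  (forall t, 0 <= t <= T ->
     0 <= fst (x t) /\ - PI <= psi t <= PI /\ -1 <= omega t <= 1 /\
     continuous_on_upto T (fun s => fst (x s)) t /\
     (0 < fst (x t) -> continuous_on_upto T (fun s => snd (x s)) t)) /\
  exists switches : list R, forall t, 0 < t < T -> ~ In t switches ->
    0 < fst (x t) /\
    is_derive (fun s => fst (x s)) t (r_rate mu (psi t)) /\
    is_derive (fun s => snd (x s)) t
      (theta_rate mu (fst (x t)) (psi t) (omega t)).

(** State-feedback strategies.  The second argument of L's strategy is the
    instantaneous control of M, see [admissible_L]. *)
Definition strategy_L : Type := state -> R -> R.
Definition strategy_M : Type := state -> R.

Definition follows_L (sigma : strategy_L) (T : R) (x : R -> state)
    (psi omega : R -> R) : Prop :=
  forall t, 0 <= t <= T -> psi t = sigma (x t) (omega t).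

Definition follows_M (tau : strategy_M) (T : R) (x : R -> state)
    (omega : R -> R) : Prop :=
  forall t, 0 <= t <= T -> omega t = tau (x t).

(** Besides the range, the periodicity and the information pattern (M's control
    is visible to L only on theta = PI), a strategy may not block the game:
    from any non-terminal state and against any control held constant by the
    opponent, some motion following the strategy starts. *)
Definition admissible_L (mu : R) (sigma : strategy_L) : Prop :=
  (forall x w, - PI <= sigma x w <= PI) /\
  (forall r theta w, sigma (r, theta + 2 * PI) w = sigma (r, theta) w) /\
  (forall x w w', ~ antipodal (snd x) -> sigma x w = sigma x w') /\
  (forall x0 w, in_game mu x0 -> 0 < fst x0 -> ~ at_E mu x0 -> -1 <= w <= 1 ->
     exists (delta : R) (x : R -> state) (psi : R -> R),
       0 < delta /\ x 0 = x0 /\ motion mu delta x psi (fun _ => w) /\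
       follows_L sigma delta x psi (fun _ => w)).

Definition admissible_M (mu : R) (tau : strategy_M) : Prop :=
  (forall x, -1 <= tau x <= 1) /\
  (forall r theta, tau (r, theta + 2 * PI) = tau (r, theta)) /\
  (forall x0 p, in_game mu x0 -> 0 < fst x0 -> ~ at_E mu x0 -> - PI <= p <= PI ->
     exists (delta : R) (x : R -> state) (omega : R -> R),
       0 < delta /\ x 0 = x0 /\ motion mu delta x (fun _ => p) omega /\
       follows_M tau delta x omega).

Definition equilibrium_play (mu : R) (sigma : strategy_L) (tau : strategy_M)
    (T : R) (x : R -> state) : Prop :=
  (exists psi omega : R -> R,
     motion mu T x psi omega /\
     follows_L sigma T x psi omega /\ follows_M tau T x omega) /\
  (forall t, 0 <= t <= T -> in_game mu (x t)) /\
  at_E mu (x T).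

(** Saddle point, with value V, of the time to reach E from [x0]: (sigma, tau)
    reaches E at time V; whatever M does, sigma reaches E by time V without
    leaving the game region; whatever L does in the game region, E is not
    reached before time V against tau. *)
Definition saddle_point (mu : R) (x0 : state) (sigma : strategy_L)
    (tau : strategy_M) (V : R) : Prop :=
  admissible_L mu sigma /\ admissible_M mu tau /\
  (exists x, x 0 = x0 /\ equilibrium_play mu sigma tau V x) /\
  (forall x psi omega,
     x 0 = x0 -> motion mu V x psi omega -> follows_L sigma V x psi omega ->
     exists t, 0 <= t <= V /\ at_E mu (x t) /\
       forall s, 0 <= s <= t -> in_game mu (x s)) /\
  (forall t x psi omega,
     x 0 = x0 -> motion mu t x psi omega -> follows_M tau t x omega ->
     (forall s, 0 <= s <= t -> in_game mu (x s)) -> at_E mu (x t) ->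
     V <= t).

(** Equilibrium trajectories are taken in the reduced range of angles. *)
Definition equilibrium_trajectory (mu : R) (sigma : strategy_L)
    (tau : strategy_M) (T : R) (x : R -> state) : Prop :=
  saddle_point mu (x 0) sigma tau T /\
  equilibrium_play mu sigma tau T x /\
  (forall t, 0 <= t <= T -> 0 <= snd (x t) <= PI).

Definition left_velocity (x : R -> state) (t : R) (v : state) : Prop :=
  filterlim (fun s => (fst (x s) - fst (x t)) / (s - t)) (at_left t)
    (locally (fst v)) /\
  filterlim (fun s => (snd (x s) - snd (x t)) / (s - t)) (at_left t)
    (locally (snd v)).

(** The trajectory [y] enters the curve [g] at the point [g s], at time [t],
    with the direction of [g]. *)
Definition enters_tangentially (y : R -> state) (t : R) (g : R -> state)
    (s : R) : Prop :=
  y t = g s /\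
  exists (v : state) (c : R),
    v <> (0, 0) /\ 0 < c /\
    is_derive (fun u => fst (g u)) s (fst v) /\
    is_derive (fun u => snd (g u)) s (snd v) /\
    left_velocity y t (c * fst v, c * snd v).

(** A tributary stays off the line before it enters it, and on it afterwards. *)
Definition tributary (mu : R) (F : state -> Prop) (g : R -> state) (s : R) :
    Prop :=
  exists (sigma : strategy_L) (tau : strategy_M) (T t1 : R) (y : R -> state),
    equilibrium_trajectory mu sigma tau T y /\
    0 < t1 < T /\
    (forall t, 0 <= t < t1 -> ~ F (y t)) /\
    (forall t, t1 <= t <= T -> F (y t)) /\
    enters_tangentially y t1 g s.

(** [g], on the half-open interval ]0, T], is a parametrization of F all of
    whose tails are equilibrium trajectories under the pair (sigma, tau); the
    interval is open at 0 because F need not contain its starting point.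
    Tributaries enter at every point of F before its end. *)
Definition focal_line (mu : R) (sigma : strategy_L) (tau : strategy_M)
    (F : state -> Prop) : Prop :=
  exists (T : R) (g : R -> state),
    0 < T /\
    (forall x, F x <-> exists t, 0 < t <= T /\ g t = x) /\
    (forall s, 0 < s <= T ->
       equilibrium_trajectory mu sigma tau (T - s) (fun t => g (s + t))) /\
    (forall s, 0 < s < T -> tributary mu F g s).

Definition FL (mu : R) (x : state) : Prop :=
  0 < fst x <= mu /\ snd x = PI.

(* Main.v *)
Require Import Defs.
From Stdlib Require Import Lra Psatz Classical.

(** On the focal line L's fixed-frame path is a semicircle of diameter [mu],
    traversed at speed [mu]; a tributary is a tangent line segment to it.
    Against M running toward L, L cannot be early: integrating her velocity
    against the heading she would have along the optimal path, with the weight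
    [1 / cos^2] on the circular part that cancels the dependence on [r] when
    [theta = PI], gives a quantity that cannot increase and would be positive at
    an early arrival in [E].  Conversely, L turns away from M at least as fast as
    M can turn: on [theta = PI] she keeps the state there and then
    [r' >= sqrt (mu^2 - r^2)], while on a tributary she steers by [r] alone, so
    that [r] is independent of M and a slower M only makes her reach
    [theta = PI] earlier. *)

(** * Monotonicity and hitting times *)

Definition cont_on (a b : R) (f : R -> R) : Prop :=
  continuous_on (fun t => a <= t <= b) f.

Lemma cont_on_eps (a b : R) (f : R -> R) (t e : R) :
  cont_on a b f -> a <= t <= b -> 0 < e ->
  exists d, 0 < d /\
    forall u, a <= u <= b -> Rabs (u - t) < d -> Rabs (f u - f t) < e.
Proof.
  intros Hf Ht He.
  destruct (proj1 (filterlim_locally f (f t)) (Hf t Ht) (mkposreal e He)) as [d Hd].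
  exists d; split; [apply cond_pos|].
  intros u Hu Hut. exact (Hd u Hut Hu).
Qed.

Lemma cont_on_intro (a b : R) (f : R -> R) :
  (forall t e, a <= t <= b -> 0 < e -> exists d, 0 < d /\
    forall u, a <= u <= b -> Rabs (u - t) < d -> Rabs (f u - f t) < e) ->
  cont_on a b f.
Proof.
  intros H t Ht. apply filterlim_locally. intros [e He].
  destruct (H t e Ht He) as [d [Hd Hu]].
  exists (mkposreal d Hd). intros u Hut Hab. exact (Hu u Hab Hut).
Qed.

Lemma cont_on_subset (a b c d : R) (f : R -> R) :
  a <= c -> d <= b -> cont_on a b f -> cont_on c d f.
Proof.
  intros Hc Hd. apply continuous_on_subset. intros; lra.
Qed.

Lemma cont_on_continuous (a b : R) (f : R -> R) :
  (forall t, a <= t <= b -> continuous f t) -> cont_on a b f.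
Proof.
  intros H t Ht P HP. apply filter_le_within. exact (H t Ht P HP).
Qed.

Lemma cont_on_derive (a b : R) (f : R -> R) :
  (forall t, a <= t <= b -> ex_derive f t) -> cont_on a b f.
Proof.
  intros H. apply cont_on_continuous. intros t Ht.
  apply (ex_derive_continuous (V := R_NormedModule)); auto.
Qed.

Lemma cont_on_ext (a b : R) (f g : R -> R) :
  (forall t, a <= t <= b -> f t = g t) -> cont_on a b f -> cont_on a b g.
Proof.
  intros H. apply continuous_on_ext. intros; now apply H.
Qed.

Lemma cont_on_comp (a b : R) (f g : R -> R) :
  cont_on a b f -> (forall t, a <= t <= b -> continuous g (f t)) ->
  cont_on a b (fun t => g (f t)).
Proof.
  intros Hf Hg t Ht.
  apply (filterlim_comp _ _ _ f g _ _ _ (Hf t Ht)). exact (Hg t Ht).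
Qed.

Lemma cont_on_plus (a b : R) (f g : R -> R) :
  cont_on a b f -> cont_on a b g -> cont_on a b (fun t => f t + g t).
Proof.
  intros Hf Hg t Ht.
  apply (filterlim_comp_2 f g Rplus (Hf t Ht) (Hg t Ht)).
  apply (filterlim_plus (V := R_NormedModule)).
Qed.

Lemma cont_on_mult (a b : R) (f g : R -> R) :
  cont_on a b f -> cont_on a b g -> cont_on a b (fun t => f t * g t).
Proof.
  intros Hf Hg t Ht.
  apply (filterlim_comp_2 f g Rmult (Hf t Ht) (Hg t Ht)).
  apply (filterlim_mult (K := R_AbsRing)).
Qed.

Lemma cont_on_opp (a b : R) (f : R -> R) :
  cont_on a b f -> cont_on a b (fun t => - f t).
Proof.
  intros Hf. apply (cont_on_comp a b f Ropp Hf).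
  intros t _. apply (continuous_opp (V := R_NormedModule) (fun x => x)).
  apply continuous_id.
Qed.

Lemma cont_on_minus (a b : R) (f g : R -> R) :
  cont_on a b f -> cont_on a b g -> cont_on a b (fun t => f t - g t).
Proof.
  intros Hf Hg. apply (cont_on_plus a b f (fun t => - g t) Hf).
  now apply cont_on_opp.
Qed.

Lemma cont_on_const (a b c : R) : cont_on a b (fun _ => c).
Proof.
  apply cont_on_continuous. intros. apply continuous_const.
Qed.

Lemma first_hit (f : R -> R) (a b : R) :
  a <= b -> cont_on a b f -> f b <= 0 ->
  exists t, a <= t <= b /\ f t <= 0 /\ forall u, a <= u < t -> 0 < f u.
Proof.
  intros Hab Hf Hb.
  destruct (Rle_dec (f a) 0) as [Ha|Ha].
  { exists a. split; [lra|]. split; [lra|]. intros; lra. }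
  set (S := fun t => a <= t <= b /\ forall u, a <= u <= t -> 0 < f u).
  destruct (completeness S) as [m [Hm1 Hm2]].
  { exists b. intros t [Ht _]. lra. }
  { exists a. split; [lra|]. intros u Hu. replace u with a by lra. lra. }
  assert (Ham : a <= m).
  { apply Hm1. split; [lra|]. intros u Hu. replace u with a by lra. lra. }
  assert (Hmb : m <= b) by (apply Hm2; intros t [Ht _]; lra).
  assert (Hpos : forall u, a <= u < m -> 0 < f u).
  { intros u Hu. destruct (Rlt_dec 0 (f u)) as [|Hn]; [assumption|exfalso].
    assert (m <= u); [|lra].
    apply Hm2. intros t [Ht Htp]. destruct (Rle_dec t u); [lra|].
    exfalso. apply Hn, Htp. lra. }
  exists m. split; [lra|]. split; [|exact Hpos].
  destruct (Rle_dec (f m) 0) as [|Hn]; [assumption|exfalso].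
  destruct (cont_on_eps a b f m (f m) Hf) as [d [Hd Hc]]; [lra|lra|].
  assert (Hnb : m < b) by (destruct Hmb; [assumption|subst; lra]).
  set (m' := Rmin b (m + d / 2)).
  assert (Hm' : m < m' <= b /\ m' <= m + d / 2).
  { unfold m'. destruct (Rle_dec b (m + d / 2)).
    - rewrite Rmin_left; lra.
    - rewrite Rmin_right; lra. }
  assert (m' <= m); [|lra].
  apply Hm1. split; [lra|]. intros u Hu.
  destruct (Rlt_dec u m); [apply Hpos; lra|].
  assert (H : Rabs (f u - f m) < f m).
  { apply Hc; [lra|]. rewrite Rabs_right; lra. }
  apply Rabs_def2 in H. lra.
Qed.

Lemma cont_on_reverse (a b : R) (f : R -> R) :
  cont_on a b f -> cont_on (- b) (- a) (fun t => f (- t)).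
Proof.
  intros Hf. apply cont_on_intro. intros t e Ht He.
  destruct (cont_on_eps a b f (- t) e Hf) as [d [Hd Hc]]; [lra|lra|].
  exists d. split; [assumption|]. intros u Hu Hut. apply Hc; [lra|].
  replace (- u - - t) with (- (u - t)) by ring. now rewrite Rabs_Ropp.
Qed.

Lemma nonincreasing_touching_open (f : R -> R) (a b : R) :
  a <= b -> cont_on a b f ->
  (forall t, a < t < b -> exists (g : R -> R) (l : R),
     is_derive g t l /\ l <= 0 /\ g t = f t /\ locally t (fun u => f u <= g u)) ->
  f b <= f a.
Proof.
  intros Hab Hf Hg.
  destruct (Rle_dec (f b) (f a)) as [|Hn]; [assumption|exfalso].
  assert (Hlt : a < b).
  { destruct Hab as [|E]; [assumption|subst; lra]. }
  set (e := (f b - f a) / (2 * (b - a))).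
  assert (He : 0 < e) by (apply Rdiv_lt_0_compat; lra).
  set (m := (f b - f a) / 4).
  set (h := fun t => f t - f a - e * (t - a) - m).
  assert (Heb : e * (b - a) = (f b - f a) / 2) by (unfold e; field; lra).
  destruct (first_hit (fun t => h (- t)) (- b) (- a)) as [t0 [Ht0 [H0 H1]]].
  { lra. }
  { apply (cont_on_reverse a b h). unfold h.
    apply cont_on_minus; [|apply cont_on_const].
    apply cont_on_minus; [apply cont_on_minus; [exact Hf|apply cont_on_const]|].
    apply cont_on_derive. intros. auto_derive. trivial. }
  { unfold h, m. rewrite Ropp_involutive. lra. }
  set (t := - t0) in *.
  assert (Hhb : 0 < h b) by (unfold h, m; lra).
  assert (Hha : h a < 0) by (unfold h, m; lra).
  assert (Htb : t < b).
  { assert (t <> b); [|unfold t in *; lra]. intros E. rewrite E in H0. lra. }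
  assert (Hafter : forall u, t < u <= b -> 0 < h u).
  { intros u Hu. rewrite <- (Ropp_involutive u). apply H1. unfold t in Hu; lra. }
  assert (Hta : a < t).
  { assert (a <= t) as [|E] by (unfold t; lra); [assumption|exfalso].
    destruct (cont_on_eps a b f a m Hf) as [d [Hd Hc]]; [lra|unfold m; lra|].
    set (u := Rmin b (a + d / 2)).
    assert (Hu : a < u <= b /\ u <= a + d / 2).
    { unfold u. destruct (Rle_dec b (a + d / 2));
        [rewrite Rmin_left|rewrite Rmin_right]; lra. }
    assert (H : Rabs (f u - f a) < m).
    { apply Hc; [lra|]. rewrite Rabs_right; lra. }
    apply Rabs_def2 in H.
    assert (0 < h u) by (apply Hafter; lra).
    unfold h in *. assert (0 <= e * (u - a)) by (apply Rmult_le_pos; lra). lra. }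
  destruct (Hg t) as [g [l [Hd [Hl [Ht Hle]]]]]; [lra|].
  apply is_derive_Reals in Hd.
  destruct (Hd (e / 2)) as [d1 Hd1]; [lra|].
  destruct Hle as [d2 Hd2].
  set (x := Rmin ((b - t)) (Rmin d1 d2) / 2).
  assert (Hx : 0 < x /\ x < b - t /\ x < d1 /\ x < d2).
  { pose proof (cond_pos d1); pose proof (cond_pos d2).
    assert (0 < Rmin (b - t) (Rmin d1 d2)).
    { apply Rmin_glb_lt; [lra|]. apply Rmin_glb_lt; assumption. }
    pose proof (Rmin_l (b - t) (Rmin d1 d2)).
    pose proof (Rmin_r (b - t) (Rmin d1 d2)).
    pose proof (Rmin_l d1 d2). pose proof (Rmin_r d1 d2).
    unfold x. lra. }
  assert (Hq : Rabs ((g (t + x) - g t) / x - l) < e / 2).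
  { apply Hd1; [lra|]. rewrite Rabs_right; lra. }
  apply Rabs_def2 in Hq.
  assert (Hgx : g (t + x) - g t <= e / 2 * x).
  { replace (g (t + x) - g t) with ((g (t + x) - g t) / x * x) by (field; lra).
    apply Rmult_le_compat_r; lra. }
  assert (Hfx : f (t + x) <= g (t + x)).
  { apply Hd2. change (Rabs (t + x - t) < d2).
    replace (t + x - t) with x by ring. rewrite Rabs_right; lra. }
  assert (Hh : 0 < h (t + x)) by (apply Hafter; lra).
  fold t in H0. unfold h in *.
  assert (0 < e * x) by (apply Rmult_lt_0_compat; lra). nra.
Qed.

Lemma nonincreasing_touching (L : list R) (f : R -> R) (a b : R) :
  a <= b -> cont_on a b f ->
  (forall t, a < t < b -> ~ In t L -> exists (g : R -> R) (l : R),
     is_derive g t l /\ l <= 0 /\ g t = f t /\ locally t (fun u => f u <= g u)) ->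
  f b <= f a.
Proof.
  revert a b. induction L as [|c L IH]; intros a b Hab Hf H.
  { apply nonincreasing_touching_open; auto. }
  destruct (Rlt_dec a c) as [Hac|Hac]; [destruct (Rlt_dec c b) as [Hcb|Hcb]|].
  - apply Rle_trans with (f c).
    + apply IH; [lra|apply (cont_on_subset a b); auto; lra|].
      intros t Ht Hn. apply H; [lra|]. intros [E|E]; [lra|auto].
    + apply IH; [lra|apply (cont_on_subset a b); auto; lra|].
      intros t Ht Hn. apply H; [lra|]. intros [E|E]; [lra|auto].
  - apply IH; auto. intros t Ht Hn. apply H; [lra|]. intros [E|E]; [lra|auto].
  - apply IH; auto. intros t Ht Hn. apply H; [lra|]. intros [E|E]; [lra|auto].
Qed.

Lemma nonincreasing_derive (L : list R) (f : R -> R) (a b : R) :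
  a <= b -> cont_on a b f ->
  (forall t, a < t < b -> ~ In t L -> exists l : R, is_derive f t l /\ l <= 0) ->
  f b <= f a.
Proof.
  intros Hab Hf H. apply (nonincreasing_touching L); auto.
  intros t Ht HL. destruct (H t Ht HL) as [l [Hd Hl]].
  exists f, l. split; [exact Hd|split; [exact Hl|split; [reflexivity|]]].
  exists (mkposreal 1 Rlt_0_1). intros; lra.
Qed.

Lemma nondecreasing_derive (L : list R) (f : R -> R) (a b : R) :
  a <= b -> cont_on a b f ->
  (forall t, a < t < b -> ~ In t L -> exists l : R, is_derive f t l /\ 0 <= l) ->
  f a <= f b.
Proof.
  intros Hab Hf H.
  assert (- f b <= - f a); [|lra].
  apply (nonincreasing_derive L (fun t => - f t)); auto using cont_on_opp.
  intros t Ht HL. destruct (H t Ht HL) as [l [Hd Hl]].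
  exists (- l). split; [|lra].
  apply (is_derive_opp (V := R_NormedModule)) in Hd. exact Hd.
Qed.

Lemma continuous_antiderivative (f : R -> R) :
  (forall t, continuous f t) ->
  exists F : R -> R, F 0 = 0 /\ forall t, is_derive F t (f t).
Proof.
  intros Hf. exists (fun t => RInt f 0 t). split.
  { exact (RInt_point (V := R_CompleteNormedModule) 0 f). }
  intros t. apply (is_derive_RInt (V := R_NormedModule) f (fun t => RInt f 0 t) 0);
    [|apply Hf].
  exists (mkposreal 1 Rlt_0_1). intros u _.
  apply (RInt_correct (V := R_CompleteNormedModule)).
  apply (ex_RInt_continuous (V := R_CompleteNormedModule)). intros; apply Hf.
Qed.

Lemma continuous_pos_interval (f : R -> R) (t0 : R) :
  continuous f t0 -> 0 < f t0 ->
  exists d, 0 < d /\ forall t, t0 - d <= t <= t0 + d -> 0 < f t.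
Proof.
  intros Hf H0.
  destruct (proj1 (filterlim_locally f (f t0)) Hf (mkposreal _ H0)) as [d Hd].
  pose proof (cond_pos d).
  exists (d / 2). split; [lra|]. intros t Ht.
  assert (H1 : Rabs (f t - f t0) < f t0).
  { apply Hd. change (Rabs (t - t0) < d). apply Rabs_def1; lra. }
  apply Rabs_def2 in H1. lra.
Qed.

(** * Lower bound for the time to E *)

Definition sgn_sin (theta : R) : R := if Rle_dec 0 (sin theta) then 1 else -1.

(** M runs toward L.  The ramp of width [eta] around [theta = 0] makes the strategy
    continuous there: with a jump, L could hold the state on [theta = 0] in a
    sliding mode that no motion following the strategy realizes. *)
Definition pursuit (eta : R) : strategy_M :=
  fun x => sgn_sin (snd x) * Rmin 1 (acos (cos (snd x)) / eta).

Lemma sgn_sin_cases (theta : R) :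
  sgn_sin theta = 1 /\ 0 <= sin theta \/ sgn_sin theta = -1 /\ sin theta < 0.
Proof.
  unfold sgn_sin. destruct (Rle_dec 0 (sin theta)); [left|right]; lra.
Qed.

Lemma sin_reduced_angle (theta : R) : sin (acos (cos theta)) = Rabs (sin theta).
Proof.
  pose proof (COS_bound theta). rewrite sin_acos by lra.
  rewrite <- sqrt_Rsqr_abs. f_equal. pose proof (sin2_cos2 theta).
  unfold Rsqr in *. lra.
Qed.

Lemma cos_reduced_angle (theta : R) : cos (acos (cos theta)) = cos theta.
Proof. apply cos_acos. pose proof (COS_bound theta); lra. Qed.

Lemma sin_sgn_reduced (theta : R) :
  sin theta = sgn_sin theta * sin (acos (cos theta)).
Proof.
  rewrite sin_reduced_angle.
  destruct (sgn_sin_cases theta) as [[-> H]|[-> H]];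
    [rewrite Rabs_right|rewrite Rabs_left]; lra.
Qed.

Lemma cos_signed_minus (e theta v a : R) :
  e = 1 \/ e = -1 -> cos theta = cos v -> sin theta = e * sin v ->
  cos (theta - e * a) = cos (v - a).
Proof.
  intros [-> | ->] Hc Hs; rewrite !cos_minus, Hc, Hs.
  - rewrite Rmult_1_l. ring.
  - replace (-1 * a) with (- a) by ring. rewrite cos_neg, sin_neg. ring.
Qed.

Lemma sin_signed_minus (e theta v a : R) :
  e = 1 \/ e = -1 -> cos theta = cos v -> sin theta = e * sin v ->
  sin (theta - e * a) = e * sin (v - a).
Proof.
  intros [-> | ->] Hc Hs; rewrite !sin_minus, Hc, Hs.
  - rewrite !Rmult_1_l. ring.
  - replace (-1 * a) with (- a) by ring. rewrite cos_neg, sin_neg. ring.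
Qed.

Lemma motion_fst_cont (mu T : R) (x : R -> state) (psi omega : R -> R) :
  motion mu T x psi omega -> cont_on 0 T (fun t => fst (x t)).
Proof. intros [_ [H _]] t Ht. apply (H t Ht). Qed.

Lemma motion_snd_cont (mu T a b : R) (x : R -> state) (psi omega : R -> R) :
  motion mu T x psi omega -> 0 <= a -> b <= T ->
  (forall t, a <= t <= b -> 0 < fst (x t)) -> cont_on a b (fun t => snd (x t)).
Proof.
  intros [_ [H _]] Ha Hb Hpos t Ht.
  assert (Ht' : 0 <= t <= T) by lra.
  destruct (H t Ht') as [_ [_ [_ [_ Hc]]]].
  specialize (Hc (Hpos t Ht)). intros P HP.
  specialize (Hc P HP). unfold filtermap, within in *.
  apply (filter_imp (F := locally t)) with (2 := Hc). intros u Hu Hab. apply Hu. lra.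
Qed.

Lemma motion_polar_cont (mu T : R) (x : R -> state) (psi omega u : R -> R) :
  motion mu T x psi omega -> (forall v, continuous u v) ->
  (forall v, Rabs (u v) <= 1) ->
  cont_on 0 T (fun t => fst (x t) * u (snd (x t))).
Proof.
  intros Hm Hu Hu1 t Ht.
  pose proof (motion_fst_cont _ _ _ _ _ Hm) as Hr.
  destruct Hm as [HT [Hm _]]. destruct (Hm t Ht) as [H0 [_ [_ [_ Hc]]]].
  destruct (Rlt_dec 0 (fst (x t))) as [Hp|Hn].
  - apply (filterlim_comp_2 (fun t => fst (x t)) (fun t => u (snd (x t))) Rmult
      (Hr t Ht) (filterlim_comp _ _ _ (fun t => snd (x t)) u _ _ _
         (Hc Hp) (Hu (snd (x t))))).
    apply (filterlim_mult (K := R_AbsRing)).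
  - assert (E : fst (x t) = 0) by lra.
    assert (Hcont : forall e, 0 < e -> exists d, 0 < d /\ forall s,
        0 <= s <= T -> Rabs (s - t) < d ->
        Rabs (fst (x s) * u (snd (x s)) - fst (x t) * u (snd (x t))) < e).
    { intros e He. destruct (cont_on_eps _ _ _ t e Hr Ht He) as [d [Hd Hs]].
      exists d. split; [assumption|]. intros s Hs0 Hs1.
      specialize (Hs s Hs0 Hs1). cbv beta in Hs.
      rewrite E in *. rewrite Rmult_0_l. rewrite Rminus_0_r in *.
      rewrite Rabs_mult. pose proof (Hu1 (snd (x s))).
      pose proof (Rabs_pos (fst (x s))). nra. }
    apply filterlim_locally. intros [e He]. destruct (Hcont e He) as [d [Hd Hs]].
    exists (mkposreal d Hd). intros s Hs1 Hs0. exact (Hs s Hs0 Hs1).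
Qed.

Lemma front_derive (e t : R) (r th lam a bet : R -> R) (r' th' lam' a' bet' : R) :
  is_derive r t r' -> is_derive th t th' -> is_derive lam t lam' ->
  is_derive a t a' -> is_derive bet t bet' ->
  is_derive (fun u => bet u - lam u * (r u * cos (th u - e * a u))) t
    (bet' - (lam' * (r t * cos (th t - e * a t)) +
       lam t * (r' * cos (th t - e * a t)
                - r t * (sin (th t - e * a t) * (th' - e * a'))))).
Proof.
  intros Hr Hth Hlam Ha Hbet.
  evar_last.
  { auto_derive; [|reflexivity].
    repeat split; eexists; eassumption. }
  change (Derive (fun u => r u) t) with (Derive r t).
  change (Derive (fun u => th u) t) with (Derive th t).
  change (Derive (fun u => lam u) t) with (Derive lam t).
  change (Derive (fun u => a u) t) with (Derive a t).
  change (Derive (fun u => bet u) t) with (Derive bet t).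
  rewrite (is_derive_unique _ _ _ Hr), (is_derive_unique _ _ _ Hth),
    (is_derive_unique _ _ _ Hlam), (is_derive_unique _ _ _ Ha),
    (is_derive_unique _ _ _ Hbet). unfold Rminus. ring.
Qed.

(** With [v] the reduced angle, [G t] is [bet t - lam t * r * cos (v - a t)], which
    is the minimum of its two smooth versions, one for each sign of [sin theta]: so
    [nonincreasing_touching] applies however often the motion changes sides. *)
Lemma front_nonincreasing (mu eta T b c : R) (x : R -> state) (psi omega : R -> R)
    (lam a bet lam' a' bet' : R -> R) :
  0 < mu -> motion mu T x psi omega -> follows_M (pursuit eta) T x omega ->
  0 <= b -> b <= c -> c <= T ->
  (forall t, b <= t <= c ->
     is_derive lam t (lam' t) /\ is_derive a t (a' t) /\ is_derive bet t (bet' t) /\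
     0 <= lam t /\ 0 <= sin (a t)) ->
  (forall t r v, b < t < c -> 0 < r -> 0 <= v <= PI ->
     bet' t + lam t * mu <=
     r * (lam' t * cos (v - a t) +
          lam t * (sin (v - a t) * (Rmin 1 (v / eta) + a' t)))) ->
  let G := fun t => bet t - lam t * (fst (x t) *
             (cos (snd (x t)) * cos (a t) + Rabs (sin (snd (x t))) * sin (a t))) in
  G c <= G b.
Proof.
  intros Hmu Hm Hfol Hb Hbc Hc Hpar Hineq G.
  pose proof Hm as [HT [Hm1 [L Hm2]]].
  apply (nonincreasing_touching L); [assumption| |].
  - assert (Hcl : cont_on b c lam).
    { apply cont_on_derive. intros t Ht. eexists. apply (Hpar t Ht). }
    assert (Hca : cont_on b c a).
    { apply cont_on_derive. intros t Ht. eexists. apply (Hpar t Ht). }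
    assert (Hcb : cont_on b c bet).
    { apply cont_on_derive. intros t Ht. eexists. apply (Hpar t Ht). }
    assert (H1 : cont_on b c (fun t => fst (x t) * cos (snd (x t)))).
    { apply (cont_on_subset 0 T); [lra|lra|].
      apply (motion_polar_cont _ _ _ _ _ cos Hm).
      - intros v. apply continuous_cos.
      - intros v. apply Rabs_le. pose proof (COS_bound v); lra. }
    assert (H2 : cont_on b c (fun t => fst (x t) * Rabs (sin (snd (x t))))).
    { apply (cont_on_subset 0 T); [lra|lra|].
      apply (motion_polar_cont _ _ _ _ _ (fun v => Rabs (sin v)) Hm).
      - intros v. apply continuous_Rabs_comp. apply continuous_sin.
      - intros v. rewrite Rabs_Rabsolu. apply Rabs_le.
        pose proof (SIN_bound v); lra. }
    apply (cont_on_ext b c (fun t => bet t - lam t *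
       (fst (x t) * cos (snd (x t)) * cos (a t)
        + fst (x t) * Rabs (sin (snd (x t))) * sin (a t)))).
    { intros t Ht. unfold G. ring. }
    apply cont_on_minus; [assumption|]. apply cont_on_mult; [assumption|].
    apply cont_on_plus; apply cont_on_mult; try assumption.
    + apply (cont_on_comp b c a cos Hca). intros; apply continuous_cos.
    + apply (cont_on_comp b c a sin Hca). intros; apply continuous_sin.
  - intros t Ht HL.
    assert (Ht' : 0 < t < T) by lra.
    destruct (Hm2 t Ht' HL) as [Hr [Hdr Hdth]].
    destruct (Hpar t) as [Hdl [Hda [Hdb [Hl Hs]]]]; [lra|].
    set (e := sgn_sin (snd (x t))).
    assert (He : e = 1 \/ e = -1).
    { unfold e. destruct (sgn_sin_cases (snd (x t))) as [[-> _]|[-> _]]; auto. }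
    exists (fun u => bet u - lam u * (fst (x u) * cos (snd (x u) - e * a u))).
    pose proof (front_derive e t _ _ _ _ _ _ _ _ _ _ Hdr Hdth Hdl Hda Hdb) as Hd.
    eexists. split; [exact Hd|].
    set (v := acos (cos (snd (x t)))) in *.
    assert (Hcv : cos (snd (x t)) = cos v) by (symmetry; apply cos_reduced_angle).
    assert (Hsv : sin (snd (x t)) = e * sin v) by apply sin_sgn_reduced.
    cbv beta.
    rewrite (cos_signed_minus e _ v _ He Hcv Hsv).
    rewrite (sin_signed_minus e _ v _ He Hcv Hsv).
    split; [|split].
    + unfold r_rate, theta_rate.
      assert (Ho : omega t = e * Rmin 1 (v / eta)) by (apply Hfol; lra).
      rewrite Ho.
      specialize (Hineq t (fst (x t)) v Ht Hr (acos_bound _)).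
      set (r := fst (x t)) in *. set (m := Rmin 1 (v / eta)) in *.
      set (ph := v - a t) in *.
      assert (Hq : mu * cos (psi t) * cos ph
          - r * (e * sin ph * (mu / r * sin (psi t) - e * m - e * a' t))
          = mu * cos (e * psi t + ph) + r * (sin ph * (m + a' t))).
      { rewrite cos_plus.
        replace (r * (e * sin ph * (mu / r * sin (psi t) - e * m - e * a' t)))
          with (mu * sin (psi t) * e * sin ph - r * (e * e) * sin ph * (m + a' t))
          by (field; lra).
        destruct He as [-> | ->].
        - replace (1 * psi t) with (psi t) by ring. ring.
        - replace (-1 * psi t) with (- psi t) by ring.
          rewrite cos_neg, sin_neg. ring. }
      rewrite Hq.
      pose proof (COS_bound (e * psi t + ph)).
      assert (- (lam t * mu) <= lam t * (mu * cos (e * psi t + ph))).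
      { assert (0 <= lam t * mu) by (apply Rmult_le_pos; lra). nra. }
      lra.
    + unfold G. rewrite Hcv, Hsv, cos_minus.
      assert (0 <= sin v).
      { unfold v. rewrite sin_reduced_angle. apply Rabs_pos. }
      replace (Rabs (e * sin v)) with (sin v); [ring|].
      rewrite Rabs_mult, (Rabs_right (sin v)) by lra.
      destruct He as [E|E]; rewrite E; [rewrite Rabs_R1|rewrite Rabs_left by lra]; ring.
    + set (d := Rmin (t - b) (c - t)).
      assert (Hd0 : 0 < d) by (unfold d; apply Rmin_glb_lt; lra).
      exists (mkposreal d Hd0). intros u Hu.
      change (Rabs (u - t) < d) in Hu. apply Rabs_def2 in Hu.
      pose proof (Rmin_l (t - b) (c - t)). pose proof (Rmin_r (t - b) (c - t)).
      fold d in H, H0.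
      destruct (Hpar u) as [_ [_ [_ [Hlu Hsu]]]]; [lra|].
      destruct (Hm1 u) as [Hru _]; [lra|].
      unfold G.
      assert (cos (snd (x u) - e * a u)
        <= cos (snd (x u)) * cos (a u) + Rabs (sin (snd (x u))) * sin (a u)).
      { rewrite cos_minus.
        pose proof (Rle_abs (sin (snd (x u)))).
        pose proof (Rle_abs (- sin (snd (x u)))). rewrite Rabs_Ropp in *.
        destruct He as [-> | ->].
        - rewrite Rmult_1_l. nra.
        - replace (-1 * a u) with (- a u) by ring. rewrite cos_neg, sin_neg. nra. }
      assert (0 <= lam u * fst (x u)) by (apply Rmult_le_pos; lra).
      nra.
Qed.

Lemma Rmin_profile (eta v : R) :
  0 < eta -> 0 <= v ->
  0 <= Rmin 1 (v / eta) <= 1 /\ (Rmin 1 (v / eta) = 1 \/ v < eta).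
Proof.
  intros He Hv.
  assert (0 <= v / eta) by (apply Rdiv_le_0_compat; lra).
  split.
  - split; [apply Rmin_glb; lra|apply Rmin_l].
  - destruct (Rlt_dec v eta) as [|Hn]; [now right|left].
    apply Rmin_left. apply Rmult_le_reg_r with eta; [assumption|].
    replace (v / eta * eta) with v by (field; lra). lra.
Qed.

Lemma not_at_E_after (mu eta T t1 t2 s : R) (x : R -> state) (psi omega : R -> R) :
  0 < mu -> 0 < eta <= PI / 2 ->
  motion mu T x psi omega -> follows_M (pursuit eta) T x omega ->
  0 <= t1 <= t2 -> t2 <= T -> 0 <= s -> t2 < t1 + PI / 2 - s ->
  - (mu * sin s * cos s) <=
    fst (x t1) * (cos (snd (x t1)) * cos s + Rabs (sin (snd (x t1))) * sin s) ->
  ~ at_E mu (x t2).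
Proof.
  intros Hmu Heta Hm Hf Ht Ht2 Hs Hlt Hstart [HE1 HE2].
  pose proof PI_RGT_0 as HPI.
  set (a := fun t : R => s + (t - t1)).
  assert (Hcos : forall t, t1 <= t <= t2 -> 0 < cos (a t)).
  { intros t Htt. apply cos_gt_0; unfold a; lra. }
  assert (Hsin : forall t, t1 <= t <= t2 -> 0 <= sin (a t)).
  { intros t Htt. apply sin_ge_0; unfold a; lra. }
  pose proof (front_nonincreasing mu eta T t1 t2 x psi omega
    (fun t => / (cos (a t)) ^ 2) a (fun t => - (mu * (sin (a t) / cos (a t))))
    (fun t => 2 * sin (a t) / (cos (a t)) ^ 3) (fun _ => 1)
    (fun t => - (mu * / (cos (a t)) ^ 2)) Hmu Hm Hf) as HG.
  cbv zeta in HG.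
  assert (H : - (mu * (sin (a t2) / cos (a t2))) - / (cos (a t2)) ^ 2 *
     (fst (x t2) * (cos (snd (x t2)) * cos (a t2)
                    + Rabs (sin (snd (x t2))) * sin (a t2))) <=
     - (mu * (sin (a t1) / cos (a t1))) - / (cos (a t1)) ^ 2 *
     (fst (x t1) * (cos (snd (x t1)) * cos (a t1)
                    + Rabs (sin (snd (x t1))) * sin (a t1)))).
  { apply HG; [lra|lra|lra| |].
    - intros t Htt. specialize (Hcos t Htt). specialize (Hsin t Htt).
      assert (Hda : is_derive a t 1) by (unfold a; auto_derive; [trivial|ring]).
      split; [|split; [exact Hda|split; [|split; [|exact Hsin]]]].
      + unfold a in *. auto_derive; [|unfold Rminus in *; field; lra].
        unfold Rminus in *. apply Rgt_not_eq. apply Rmult_lt_0_compat; lra.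
      + unfold a in *. auto_derive; [unfold Rminus in *; lra|].
        pose proof (sin2_cos2 (s + (t - t1))) as Hsc. unfold Rsqr in Hsc.
        replace (/ cos (s + (t - t1)) ^ 2) with
          ((sin (s + (t - t1)) * sin (s + (t - t1)) +
            cos (s + (t - t1)) * cos (s + (t - t1))) * / cos (s + (t - t1)) ^ 2)
          by (rewrite Hsc; ring).
        unfold Rminus in *. field. lra.
      + apply Rlt_le, Rinv_0_lt_compat, pow_lt, Hcos.
    - intros t r v Htt Hr Hv.
      assert (Htt' : t1 <= t <= t2) by lra.
      specialize (Hcos t Htt'). specialize (Hsin t Htt').
      replace (- (mu * / cos (a t) ^ 2) + / cos (a t) ^ 2 * mu) with 0 by ring.
      destruct (Rmin_profile eta v) as [Hm01 Hmc]; [lra|lra|].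
      set (m := Rmin 1 (v / eta)) in *.
      apply Rmult_le_pos; [lra|].
      replace (2 * sin (a t) / cos (a t) ^ 3 * cos (v - a t)
               + / cos (a t) ^ 2 * (sin (v - a t) * (m + 1)))
        with ((2 * sin (a t) * cos (v - a t) + 2 * cos (a t) * sin (v - a t)
               - (1 - m) * cos (a t) * sin (v - a t)) * / cos (a t) ^ 3)
        by (field; lra).
      apply Rmult_le_pos; [|apply Rlt_le, Rinv_0_lt_compat, pow_lt, Hcos].
      replace (2 * sin (a t) * cos (v - a t) + 2 * cos (a t) * sin (v - a t))
        with (2 * sin v)
        by (replace (sin v) with (sin (a t + (v - a t))) by (f_equal; ring);
            rewrite sin_plus; ring).
      assert (Hsv : 0 <= sin v) by (apply sin_ge_0; lra).
      destruct Hmc as [E|Hlt2]; [rewrite E; nra|].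
      pose proof (COS_bound (a t)).
      assert (Hle : sin (v - a t) <= sin v).
      { apply sin_incr_1; unfold a in *; lra. }
      assert (Hk : 0 <= (1 - m) * cos (a t) <= 1) by nra.
      nra. }
  replace (a t1) with s in H by (unfold a; ring).
  assert (Hc2 : 0 < cos (a t2)) by (apply Hcos; lra).
  assert (Hc1 : 0 < cos s) by (apply cos_gt_0; lra).
  assert (Hs0 : sin (snd (x t2)) = 0).
  { pose proof (sin2_cos2 (snd (x t2))). unfold antipodal in HE2.
    rewrite HE2 in *. unfold Rsqr in *. nra. }
  unfold antipodal in HE2. rewrite HE1, HE2, Hs0, Rabs_R0 in H.
  replace (- (mu * (sin (a t2) / cos (a t2))) - / cos (a t2) ^ 2 *
           (mu * (-1 * cos (a t2) + 0 * sin (a t2))))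
    with (mu * ((1 - sin (a t2)) / cos (a t2))) in H by (field; lra).
  set (X := fst (x t1) * _) in *.
  replace (- (mu * (sin s / cos s)) - / cos s ^ 2 * X)
    with (- ((mu * sin s * cos s + X) * / cos s ^ 2)) in H by (field; lra).
  assert (0 <= (mu * sin s * cos s + X) * / cos s ^ 2).
  { apply Rmult_le_pos; [lra|]. apply Rlt_le, Rinv_0_lt_compat, pow_lt, Hc1. }
  assert (sin (a t2) < 1).
  { rewrite <- sin_PI2. apply sin_increasing_1; unfold a in *; lra. }
  assert (0 < mu * ((1 - sin (a t2)) / cos (a t2))).
  { apply Rmult_lt_0_compat; [assumption|]. apply Rdiv_lt_0_compat; lra. }
  lra.
Qed.

Lemma pursuit_front_before (mu eta T t1 t2 s : R) (x : R -> state)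
    (psi omega : R -> R) :
  0 < mu -> 0 < eta <= s ->
  motion mu T x psi omega -> follows_M (pursuit eta) T x omega ->
  0 <= t2 <= t1 -> t2 <= T -> s + t1 <= PI ->
  let X := fun t => fst (x t) * (cos (snd (x t)) * cos (s + (t1 - t))
             + Rabs (sin (snd (x t))) * sin (s + (t1 - t))) in
  X 0 - mu * t1 <= X t2 - mu * (t1 - t2).
Proof.
  intros Hmu Heta Hm Hf Ht Ht2 Hs X.
  pose proof (front_nonincreasing mu eta T 0 t2 x psi omega
    (fun t => 1) (fun t => s + (t1 - t)) (fun t => mu * (t1 - t))
    (fun _ => 0) (fun _ => -1) (fun t => - mu) Hmu Hm Hf) as HG.
  cbv zeta in HG.
  assert (H : mu * (t1 - t2) - 1 * X t2 <= mu * (t1 - 0) - 1 * X 0); [|lra].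
  apply HG; [lra|lra|lra| |].
  - intros t Htt. split; [|split; [|split; [|split; [lra|]]]].
    + auto_derive; [trivial|ring].
    + auto_derive; [trivial|ring].
    + auto_derive; [trivial|ring].
    + apply sin_ge_0; lra.
  - intros t r v Htt Hr Hv.
    replace (- mu + 1 * mu) with 0 by ring.
    destruct (Rmin_profile eta v) as [Hm01 Hmc]; [lra|lra|].
    set (m := Rmin 1 (v / eta)) in *.
    apply Rmult_le_pos; [lra|].
    destruct Hmc as [E|Hlt2]; [rewrite E; lra|].
    assert (sin (v - (s + (t1 - t))) <= 0).
    { rewrite <- (Ropp_involutive (sin _)), <- sin_neg.
      assert (0 <= sin (- (v - (s + (t1 - t))))) by (apply sin_ge_0; lra). lra. }
    nra.
Qed.

Lemma not_at_E_before (mu eta T t1 t2 s : R) (x : R -> state)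
    (psi omega : R -> R) :
  0 < mu -> 0 < eta <= s ->
  motion mu T x psi omega -> follows_M (pursuit eta) T x omega ->
  0 <= t2 <= t1 -> t2 <= T -> s + t1 <= PI -> s < PI / 2 ->
  mu * t1 - mu * sin s * cos s <=
    fst (x 0) * (cos (snd (x 0)) * cos (s + t1)
                 + Rabs (sin (snd (x 0))) * sin (s + t1)) ->
  ~ at_E mu (x t2).
Proof.
  intros Hmu Heta Hm Hf Ht Ht2 Hs Hs2 Hstart [HE1 HE2].
  pose proof (pursuit_front_before mu eta T t1 t2 s x psi omega Hmu Heta Hm Hf
    Ht Ht2 Hs) as H. cbv beta zeta in H. rewrite Rminus_0_r in H.
  assert (Hs0 : sin (snd (x t2)) = 0).
  { pose proof (sin2_cos2 (snd (x t2))). unfold antipodal in HE2.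
    rewrite HE2 in *. unfold Rsqr in *. nra. }
  unfold antipodal in HE2. rewrite HE1, HE2, Hs0, Rabs_R0 in H.
  assert (Hmon : cos s + s <= cos (s + (t1 - t2)) + (s + (t1 - t2))).
  { apply (nondecreasing_derive nil (fun u => cos u + u)); [lra| |].
    - apply cont_on_derive. intros u Hu. auto_derive. trivial.
    - intros u Hu _. exists (- sin u + 1). split.
      + auto_derive; [trivial|ring].
      + pose proof (SIN_bound u). lra. }
  assert (0 < cos s) by (apply cos_gt_0; lra).
  assert (sin s < 1).
  { rewrite <- sin_PI2. apply sin_increasing_1; lra. }
  assert (mu * cos s <= mu * (cos (s + (t1 - t2)) + (t1 - t2)))
    by (apply Rmult_le_compat_l; lra).
  assert (0 < mu * (cos s * (1 - sin s)))
    by (apply Rmult_lt_0_compat; [|apply Rmult_lt_0_compat]; lra).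
  lra.
Qed.

(** * Motions against a constant heading of L *)

Lemma pursuit_at_PI (eta r theta : R) :
  0 < eta <= PI / 2 -> cos theta = -1 -> pursuit eta (r, theta) = 1.
Proof.
  intros He Hc. pose proof PI_RGT_0. unfold pursuit; simpl.
  assert (Hs : sin theta = 0).
  { pose proof (sin2_cos2 theta) as Hsc. rewrite Hc in Hsc. unfold Rsqr in Hsc. nra. }
  destruct (sgn_sin_cases theta) as [[-> _]|[_ H1]]; [|lra].
  rewrite Hc, <- cos_PI, acos_cos by lra.
  rewrite Rmin_left; [ring|].
  apply Rmult_le_reg_r with eta; [lra|]. replace (PI / eta * eta) with PI by (field; lra).
  lra.
Qed.

Lemma pursuit_saturated (eta e r theta v : R) :
  0 < eta <= PI / 2 -> e = 1 \/ e = -1 -> cos theta = cos v ->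
  sin theta = e * sin v -> eta <= v < PI -> pursuit eta (r, theta) = e.
Proof.
  intros He Hee Hc Hs Hv. unfold pursuit; simpl.
  assert (0 < sin v) by (apply sin_gt_0; lra).
  rewrite Hc, acos_cos by lra.
  rewrite Rmin_left.
  - destruct (sgn_sin_cases theta) as [[-> H1]|[-> H1]]; destruct Hee as [-> | ->]; nra.
  - apply Rmult_le_reg_r with eta; [lra|]. replace (v / eta * eta) with v by (field; lra).
    lra.
Qed.

Lemma pursuit_linear (eta e r theta v : R) :
  0 < eta <= PI / 2 -> e = 1 \/ e = -1 -> cos theta = cos v ->
  sin theta = e * sin v -> - eta <= v <= eta ->
  pursuit eta (r, theta) = e * (v / eta).
Proof.
  intros He Hee Hc Hs Hv. unfold pursuit; simpl.
  pose proof PI_RGT_0.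
  assert (Hk : 0 < / eta) by (apply Rinv_0_lt_compat; lra).
  assert (Hm : forall w, 0 <= w <= eta -> Rmin 1 (w / eta) = w / eta).
  { intros w Hw. apply Rmin_right.
    apply Rmult_le_reg_r with eta; [lra|]. replace (w / eta * eta) with w by (field; lra).
    lra. }
  rewrite Hc.
  destruct (Rtotal_order v 0) as [Hlt|[E|Hgt]].
  - assert (0 < sin (- v)) by (apply sin_gt_0; lra). rewrite sin_neg in *.
    rewrite <- cos_neg, acos_cos by lra. rewrite Hm by lra.
    destruct (sgn_sin_cases theta) as [[-> H1]|[-> H1]]; destruct Hee as [-> | ->];
      solve [nra | unfold Rdiv; ring].
  - subst v. rewrite cos_0, acos_1. rewrite Hm by lra. unfold Rdiv. ring.
  - assert (0 < sin v) by (apply sin_gt_0; lra).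
    rewrite acos_cos by lra. rewrite Hm by lra.
    destruct (sgn_sin_cases theta) as [[-> H1]|[-> H1]]; destruct Hee as [-> | ->];
      solve [nra | unfold Rdiv; ring].
Qed.

Lemma pursuit_beyond (eta r theta v : R) :
  0 < eta <= PI / 2 -> cos theta = cos v -> sin theta = sin v ->
  PI < v <= 3 * (PI / 2) -> pursuit eta (r, theta) = -1.
Proof.
  intros He Hc Hs Hv. unfold pursuit; simpl. pose proof PI_RGT_0.
  assert (Hs' : sin v < 0) by (apply sin_lt_0; lra).
  destruct (sgn_sin_cases theta) as [[_ H1]|[-> H1]]; [lra|].
  rewrite Hc. replace (cos v) with (cos (2 * PI - v)).
  2:{ rewrite cos_minus, cos_2PI, sin_2PI. ring. }
  rewrite acos_cos by lra.
  rewrite Rmin_left; [ring|].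
  apply Rmult_le_reg_r with eta; [lra|].
  replace ((2 * PI - v) / eta * eta) with (2 * PI - v) by (field; lra). lra.
Qed.

Lemma pursuit_bounds (eta : R) (x : state) : 0 < eta -> -1 <= pursuit eta x <= 1.
Proof.
  intros He. unfold pursuit.
  destruct (Rmin_profile eta (acos (cos (snd x))) He) as [H _]; [apply acos_bound|].
  destruct (sgn_sin_cases (snd x)) as [[-> _]|[-> _]]; lra.
Qed.

Lemma affine_sign (u c : R) :
  exists d, 0 < d /\ ((forall t, 0 <= t <= d -> u + c * t <= 0) \/
                      (forall t, 0 < t <= d -> 0 < u + c * t)).
Proof.
  assert (Hcont : forall u', continuous (fun t => u' + c * t) 0).
  { intros u'. apply (ex_derive_continuous (V := R_NormedModule)).
    auto_derive. trivial. }
  destruct (Rtotal_order u 0) as [Hlt|[->|Hgt]].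
  - destruct (continuous_pos_interval (fun t => - u + - c * t) 0) as [d [Hd Hp]].
    + apply (ex_derive_continuous (V := R_NormedModule)). auto_derive. trivial.
    + lra.
    + exists d. split; [assumption|left]. intros t Ht. specialize (Hp t). lra.
  - exists 1. split; [lra|].
    destruct (Rle_dec c 0); [left|right]; intros t Ht; nra.
  - destruct (continuous_pos_interval (fun t => u + c * t) 0 (Hcont u)) as [d [Hd Hp]].
    + lra.
    + exists d. split; [assumption|right]. intros t Ht. apply Hp. lra.
Qed.

Lemma cos_signed_shift (e theta v w : R) :
  e = 1 \/ e = -1 -> cos theta = cos v -> sin theta = e * sin v ->
  cos (theta + e * (w - v)) = cos w.
Proof.
  intros He Hc Hs. replace (theta + e * (w - v)) with (theta - e * (v - w)) by ring.
  rewrite (cos_signed_minus e theta v _ He Hc Hs). f_equal. ring.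
Qed.

Lemma sin_signed_shift (e theta v w : R) :
  e = 1 \/ e = -1 -> cos theta = cos v -> sin theta = e * sin v ->
  sin (theta + e * (w - v)) = e * sin w.
Proof.
  intros He Hc Hs. replace (theta + e * (w - v)) with (theta - e * (v - w)) by ring.
  rewrite (sin_signed_minus e theta v _ He Hc Hs). do 2 f_equal. ring.
Qed.

Lemma motion_against_constant_heading (mu eta p r0 th0 e : R) (v m : R -> R) (d : R) :
  0 < eta -> - PI <= p <= PI -> 0 < d -> e = 1 \/ e = -1 ->
  (forall t, 0 <= t <= d -> 0 < r0 + mu * cos p * t /\ ex_derive v t) ->
  (forall t, 0 < t < d ->
     is_derive v t (e * (mu * sin p) / (r0 + mu * cos p * t) - m t) /\
     pursuit eta (r0 + mu * cos p * t, th0 + e * (v t - v 0)) = e * m t) ->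
  exists (delta : R) (x : R -> state) (omega : R -> R),
    0 < delta /\ x 0 = (r0, th0) /\ motion mu delta x (fun _ => p) omega /\
    follows_M (pursuit eta) delta x omega.
Proof.
  intros Heta Hp Hd He H1 H2.
  set (x := fun t => (r0 + mu * cos p * t, th0 + e * (v t - v 0))).
  exists d, x, (fun t => pursuit eta (x t)).
  split; [assumption|]. split; [unfold x; f_equal; ring|].
  split; [|intros t _; reflexivity].
  split; [lra|]. split.
  - intros t Ht. destruct (H1 t Ht) as [Hr Hv].
    split; [simpl; lra|]. split; [assumption|].
    split; [apply pursuit_bounds; assumption|]. split; [|intros _].
    + apply (cont_on_derive 0 d (fun s => fst (x s))); [|exact Ht].
      intros s _. simpl. auto_derive. trivial.
    + apply (cont_on_derive 0 d (fun s => snd (x s))); [|exact Ht].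
      intros s Hs. simpl. auto_derive. apply (H1 s Hs).
  - exists nil. intros t Ht _. destruct (H1 t) as [Hr _]; [lra|].
    destruct (H2 t Ht) as [Hv Hm].
    split; [assumption|]. split.
    + simpl. unfold r_rate. auto_derive; [trivial|ring].
    + change (is_derive (fun s => th0 + e * (v s - v 0)) t
        (theta_rate mu (r0 + mu * cos p * t) p (pursuit eta (x t)))).
      unfold x. rewrite Hm. unfold theta_rate.
      evar_last.
      { auto_derive; [repeat split; eexists; exact Hv|reflexivity]. }
      change (Derive (fun s => v s) t) with (Derive v t).
      rewrite (is_derive_unique _ _ _ Hv).
      destruct He as [-> | ->]; field; lra.
Qed.

Lemma pursuit_motion_exists (mu eta p r0 th0 : R) :
  0 < mu -> 0 < eta <= PI / 2 -> 0 < r0 -> - PI <= p <= PI ->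
  exists (delta : R) (x : R -> state) (omega : R -> R),
    0 < delta /\ x 0 = (r0, th0) /\ motion mu delta x (fun _ => p) omega /\
    follows_M (pursuit eta) delta x omega.
Proof.
  intros Hmu Heta Hr0 Hp. pose proof PI_RGT_0 as HPI.
  set (e := sgn_sin th0). set (v0 := acos (cos th0)).
  assert (He : e = 1 \/ e = -1).
  { unfold e. destruct (sgn_sin_cases th0) as [[-> _]|[-> _]]; auto. }
  assert (Hc0 : cos th0 = cos v0) by (symmetry; apply cos_reduced_angle).
  assert (Hs0 : sin th0 = e * sin v0) by apply sin_sgn_reduced.
  pose proof (acos_bound (cos th0)) as Hv0. fold v0 in Hv0.
  set (r := fun t => r0 + mu * cos p * t).
  set (b := e * (mu * sin p)).
  set (A := fun t => b / (r0 / 2 + Rabs (r t - r0 / 2))).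
  assert (HcA : forall t, continuous A t).
  { intros t. unfold A.
    apply (continuous_mult (K := R_AbsRing) (fun _ => b)); [apply continuous_const|].
    apply continuous_Rinv_comp.
    - apply (continuous_plus (V := R_NormedModule) (fun _ => r0 / 2));
        [apply continuous_const|].
      apply continuous_Rabs_comp.
      apply (ex_derive_continuous (V := R_NormedModule)). unfold r. auto_derive. trivial.
    - pose proof (Rabs_pos (r t - r0 / 2)). lra. }
  assert (Hrd : exists d, 0 < d /\ forall t, - d <= t <= d -> r0 / 2 < r t).
  { destruct (continuous_pos_interval (fun t => r t - r0 / 2) 0) as [d [Hd Hpos]].
    - apply (ex_derive_continuous (V := R_NormedModule)). unfold r. auto_derive. trivial.
    - unfold r. lra.
    - exists d. split; [assumption|]. intros t Ht. specialize (Hpos t). lra. }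
  destruct Hrd as [d0 [Hd0 Hr]].
  assert (HA : forall t, - d0 <= t <= d0 -> A t = b / r t).
  { intros t Ht. unfold A. specialize (Hr t Ht). rewrite Rabs_right by lra.
    f_equal. ring. }
  destruct (continuous_antiderivative A HcA) as [F [HF0 HF]].
  set (k := / eta).
  assert (Hk : 0 < k) by (apply Rinv_0_lt_compat; lra).
  assert (Hek : eta * k = 1) by (unfold k; field; lra).
  assert (HcE : forall t, continuous (fun t => exp (k * t) * A t) t).
  { intros t. apply (continuous_mult (K := R_AbsRing) (fun t => exp (k * t))); [|apply HcA].
    apply (ex_derive_continuous (V := R_NormedModule)). auto_derive. trivial. }
  destruct (continuous_antiderivative _ HcE) as [E [HE0 HE]].
  set (vc := fun c t => v0 + F t - c * t).
  assert (Hvc : forall c t, is_derive (vc c) t (A t - c)).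
  { intros c t. unfold vc. evar_last.
    - auto_derive; [repeat split; eexists; apply HF|reflexivity].
    - change (Derive (fun x => F x) t) with (Derive F t).
      rewrite (is_derive_unique _ _ _ (HF t)). ring. }
  assert (Hvc0 : forall c, vc c 0 = v0) by (intros; unfold vc; rewrite HF0; ring).
  set (vl := fun t => exp (- k * t) * (v0 + E t)).
  assert (Hvl : forall t, is_derive vl t (A t - vl t / eta)).
  { intros t. unfold vl. evar_last.
    - auto_derive; [repeat split; eexists; apply HE|reflexivity].
    - change (Derive (fun x => E x) t) with (Derive E t).
      rewrite (is_derive_unique _ _ _ (HE t)).
      assert (Hee : exp (- k * t) * exp (k * t) = 1).
      { rewrite <- exp_plus. replace (- k * t + k * t) with 0 by ring. apply exp_0. }
      transitivity (exp (- k * t) * exp (k * t) * A t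
                    - k * exp (- k * t) * (v0 + E t)); [ring|].
      rewrite Hee. unfold Rdiv. fold k. ring. }
  assert (Hvl0 : vl 0 = v0).
  { unfold vl. rewrite HE0, Rmult_0_r, exp_0. ring. }
  (* The regime of [pursuit] in which the solution stays depends on [v0] and, at
     the corners [v0 = eta] and [v0 = PI], on the sign of [A - 1] just after 0. *)
  assert (Hconst : forall c d, 0 < d -> d <= d0 ->
    (forall t, 0 < t < d -> pursuit eta (r t, th0 + e * (vc c t - v0)) = e * c) ->
    exists (delta : R) (x : R -> state) (omega : R -> R),
      0 < delta /\ x 0 = (r0, th0) /\ motion mu delta x (fun _ => p) omega /\
      follows_M (pursuit eta) delta x omega).
  { intros c d Hd Hdd Hpur.
    apply (motion_against_constant_heading mu eta p r0 th0 e (vc c) (fun _ => c) d);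
      auto; [lra| |].
    - intros t Ht. split; [|eexists; apply Hvc].
      assert (r0 / 2 < r t) by (apply Hr; lra). unfold r in *. lra.
    - intros t Ht. rewrite Hvc0. split; [|apply Hpur; assumption].
      specialize (Hvc c t). rewrite HA in Hvc by lra. exact Hvc. }
  assert (Hlin : forall d, 0 < d -> d <= d0 ->
    (forall t, 0 < t < d -> - eta <= vl t <= eta) ->
    exists (delta : R) (x : R -> state) (omega : R -> R),
      0 < delta /\ x 0 = (r0, th0) /\ motion mu delta x (fun _ => p) omega /\
      follows_M (pursuit eta) delta x omega).
  { intros d Hd Hdd Hbd.
    apply (motion_against_constant_heading mu eta p r0 th0 e vl (fun t => vl t / eta) d);
      auto; [lra| |].
    - intros t Ht. split; [|eexists; apply Hvl].
      assert (r0 / 2 < r t) by (apply Hr; lra). unfold r in *. lra.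
    - intros t Ht. rewrite Hvl0. split.
      + pose proof (Hvl t) as Hvlt. rewrite HA in Hvlt by lra. exact Hvlt.
      + apply pursuit_linear; auto.
        * apply cos_signed_shift; auto.
        * apply sin_signed_shift; auto. }
  assert (Hnear : forall (f : R -> R) c, ex_derive f 0 -> f 0 < c ->
    exists d, 0 < d /\ forall t, - d <= t <= d -> f t < c).
  { intros f c Hf Hfc.
    destruct (continuous_pos_interval (fun t => c - f t) 0) as [d [Hd Hpos]].
    - apply (continuous_minus (V := R_NormedModule) (fun _ => c));
        [apply continuous_const|].
      now apply (ex_derive_continuous (V := R_NormedModule)).
    - lra.
    - exists d. split; [assumption|]. intros t Ht. specialize (Hpos t). lra. }
  assert (Hnear' : forall (f : R -> R) c, ex_derive f 0 -> c < f 0 ->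
    exists d, 0 < d /\ forall t, - d <= t <= d -> c < f t).
  { intros f c Hf Hfc.
    destruct (continuous_pos_interval (fun t => f t - c) 0) as [d [Hd Hpos]].
    - apply (continuous_minus (V := R_NormedModule) f (fun _ => c));
        [|apply continuous_const].
      now apply (ex_derive_continuous (V := R_NormedModule)).
    - lra.
    - exists d. split; [assumption|]. intros t Ht. specialize (Hpos t). lra. }
  destruct (affine_sign (b - r0) (- (mu * cos p))) as [d1 [Hd1 Hsign]].
  assert (HA1 : (forall t, 0 <= t -> t <= d0 -> t <= d1 -> A t <= 1) \/
                (forall t, 0 < t -> t <= d0 -> t <= d1 -> 1 < A t)).
  { destruct Hsign as [Hs|Hs]; [left|right]; intros t Ht Ht0 Ht1;
      rewrite HA by lra; assert (Hrt : r0 / 2 < r t) by (apply Hr; lra);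
      specialize (Hs t); unfold r in *.
    - apply (Rdiv_le_1 b); lra.
    - apply Rmult_lt_reg_r with (r0 + mu * cos p * t); [lra|].
      replace (b / (r0 + mu * cos p * t) * (r0 + mu * cos p * t)) with b
        by (field; lra). lra. }
  assert (Hvmon : forall c t, 0 <= t -> (forall u, 0 < u < t -> A u <= c) ->
            vc c t <= v0).
  { intros c t Ht HAc. rewrite <- (Hvc0 c).
    apply (nonincreasing_derive nil); [assumption| |].
    - apply cont_on_derive. intros; eexists; apply Hvc.
    - intros u Hu _. exists (A u - c). split; [apply Hvc|]. specialize (HAc u Hu). lra. }
  assert (Hvmon' : forall c t, 0 <= t -> (forall u, 0 < u < t -> c <= A u) ->
            v0 <= vc c t).
  { intros c t Ht HAc. rewrite <- (Hvc0 c).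
    apply (nondecreasing_derive nil); [assumption| |].
    - apply cont_on_derive. intros; eexists; apply Hvc.
    - intros u Hu _. exists (A u - c). split; [apply Hvc|]. specialize (HAc u Hu). lra. }
  destruct (Rle_lt_or_eq_dec v0 PI (proj2 Hv0)) as [HvPI|HvPI].
  - destruct (Hnear (vc 1) PI) as [d2 [Hd2 Hup]];
      [eexists; apply Hvc|rewrite Hvc0; assumption|].
    destruct (Rtotal_order v0 eta) as [Hlt|[Heq|Hgt]].
    + destruct (Hnear vl eta) as [d3 [Hd3 H3]]; [eexists; apply Hvl|lra|].
      destruct (Hnear' vl (- eta)) as [d4 [Hd4 H4]]; [eexists; apply Hvl|lra|].
      set (d := Rmin d0 (Rmin d3 d4)).
      assert (Hd : 0 < d) by (unfold d; repeat apply Rmin_glb_lt; assumption).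
      assert (Hdl : d <= d0 /\ d <= d3 /\ d <= d4).
      { unfold d. pose proof (Rmin_l d0 (Rmin d3 d4)).
        pose proof (Rmin_r d0 (Rmin d3 d4)).
        pose proof (Rmin_l d3 d4). pose proof (Rmin_r d3 d4). lra. }
      apply (Hlin d); [assumption|lra|]. intros t Ht.
      specialize (H3 t). specialize (H4 t). lra.
    + destruct HA1 as [HA1|HA1].
      * destruct (Hnear' vl (- eta)) as [d4 [Hd4 H4]]; [eexists; apply Hvl|lra|].
        set (d := Rmin d0 (Rmin d1 d4)).
        assert (Hd : 0 < d) by (unfold d; repeat apply Rmin_glb_lt; assumption).
        assert (Hdl : d <= d0 /\ d <= d1 /\ d <= d4).
        { unfold d. pose proof (Rmin_l d0 (Rmin d1 d4)).
          pose proof (Rmin_r d0 (Rmin d1 d4)).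
          pose proof (Rmin_l d1 d4). pose proof (Rmin_r d1 d4). lra. }
        apply (Hlin d); [assumption|lra|]. intros t Ht.
        specialize (H4 t). split; [lra|].
        assert (Hw : E t - eta * exp (k * t) <= E 0 - eta * exp (k * 0)).
        { apply (nonincreasing_derive nil (fun s => E s - eta * exp (k * s))); [lra| |].
          - apply cont_on_derive. intros s Hs. auto_derive.
            repeat split; eexists; apply HE.
          - intros s Hs _. exists (exp (k * s) * (A s - 1)). split.
            + evar_last.
              * auto_derive; [repeat split; eexists; apply HE|reflexivity].
              * change (Derive (fun x => E x) s) with (Derive E s).
                rewrite (is_derive_unique _ _ _ (HE s)).
                transitivity (exp (k * s) * (A s - eta * k)); [ring|].
                rewrite Hek. reflexivity.
            + assert (A s <= 1) by (apply HA1; lra).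
              pose proof (exp_pos (k * s)). nra. }
        rewrite HE0, Rmult_0_r, exp_0 in Hw.
        assert (Hee : exp (- k * t) * exp (k * t) = 1).
        { rewrite <- exp_plus. replace (- k * t + k * t) with 0 by ring. apply exp_0. }
        unfold vl. pose proof (exp_pos (- k * t)).
        apply Rle_trans with (exp (- k * t) * (eta * exp (k * t))); [|nra].
        apply Rmult_le_compat_l; lra.
      * set (d := Rmin d0 (Rmin d1 d2)).
        assert (Hd : 0 < d) by (unfold d; repeat apply Rmin_glb_lt; assumption).
        assert (Hdl : d <= d0 /\ d <= d1 /\ d <= d2).
        { unfold d. pose proof (Rmin_l d0 (Rmin d1 d2)).
          pose proof (Rmin_r d0 (Rmin d1 d2)).
          pose proof (Rmin_l d1 d2). pose proof (Rmin_r d1 d2). lra. }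
        apply (Hconst 1 d); [assumption|lra|]. intros t Ht. rewrite Rmult_1_r.
        apply pursuit_saturated with (v := vc 1 t); auto.
        -- apply cos_signed_shift; auto.
        -- apply sin_signed_shift; auto.
        -- split; [|apply Hup; lra]. rewrite <- Heq. apply Hvmon'; [lra|].
           intros u Hu. left. apply HA1; lra.
    + destruct (Hnear' (vc 1) eta) as [d3 [Hd3 H3]];
        [eexists; apply Hvc|rewrite Hvc0; lra|].
      set (d := Rmin d0 (Rmin d2 d3)).
      assert (Hd : 0 < d) by (unfold d; repeat apply Rmin_glb_lt; assumption).
      assert (Hdl : d <= d0 /\ d <= d2 /\ d <= d3).
      { unfold d. pose proof (Rmin_l d0 (Rmin d2 d3)).
        pose proof (Rmin_r d0 (Rmin d2 d3)).
        pose proof (Rmin_l d2 d3). pose proof (Rmin_r d2 d3). lra. }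
      apply (Hconst 1 d); [assumption|lra|]. intros t Ht. rewrite Rmult_1_r.
      apply pursuit_saturated with (v := vc 1 t); auto.
      * apply cos_signed_shift; auto.
      * apply sin_signed_shift; auto.
      * split; [left; apply H3; lra|apply Hup; lra].
  - assert (He1 : e = 1).
    { unfold e. destruct (sgn_sin_cases th0) as [[-> _]|[_ Hneg]]; [reflexivity|].
      rewrite HvPI, sin_PI in Hs0. lra. }
    destruct HA1 as [HA1|HA1].
    + destruct (Hnear' (vc 1) eta) as [d3 [Hd3 H3]];
        [eexists; apply Hvc|rewrite Hvc0; lra|].
      set (d := Rmin d0 (Rmin d1 d3)).
      assert (Hd : 0 < d) by (unfold d; repeat apply Rmin_glb_lt; assumption).
      assert (Hdl : d <= d0 /\ d <= d1 /\ d <= d3).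
      { unfold d. pose proof (Rmin_l d0 (Rmin d1 d3)).
        pose proof (Rmin_r d0 (Rmin d1 d3)).
        pose proof (Rmin_l d1 d3). pose proof (Rmin_r d1 d3). lra. }
      apply (Hconst 1 d); [assumption|lra|]. intros t Ht. rewrite Rmult_1_r.
      assert (Hle : vc 1 t <= v0).
      { apply Hvmon; [lra|]. intros u Hu. apply HA1; lra. }
      assert (eta < vc 1 t) by (apply H3; lra).
      destruct (Rle_lt_or_eq_dec (vc 1 t) PI) as [Hlt|Heq]; [lra| |].
      * apply pursuit_saturated with (v := vc 1 t); auto.
        -- apply cos_signed_shift; auto.
        -- apply sin_signed_shift; auto.
        -- lra.
      * rewrite He1. apply pursuit_at_PI; [assumption|].
        rewrite <- cos_PI, <- Heq, <- He1. apply cos_signed_shift; auto.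
    + destruct (Hnear (vc (-1)) (3 * (PI / 2))) as [d3 [Hd3 H3]];
        [eexists; apply Hvc|rewrite Hvc0; lra|].
      set (d := Rmin d0 (Rmin d1 d3)).
      assert (Hd : 0 < d) by (unfold d; repeat apply Rmin_glb_lt; assumption).
      assert (Hdl : d <= d0 /\ d <= d1 /\ d <= d3).
      { unfold d. pose proof (Rmin_l d0 (Rmin d1 d3)).
        pose proof (Rmin_r d0 (Rmin d1 d3)).
        pose proof (Rmin_l d1 d3). pose proof (Rmin_r d1 d3). lra. }
      apply (Hconst (-1) d); [assumption|lra|]. intros t Ht.
      rewrite He1 at 2. rewrite Rmult_1_l.
      assert (vc (-1) t < 3 * (PI / 2)) by (apply H3; lra).
      assert (v0 <= vc 1 t).
      { apply Hvmon'; [lra|]. intros u Hu. left. apply HA1; lra. }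
      apply pursuit_beyond with (v := vc (-1) t); [assumption| | |].
      * apply cos_signed_shift; auto.
      * rewrite (sin_signed_shift e th0 v0); auto. rewrite He1. ring.
      * unfold vc in *. lra.
Qed.

Lemma pursuit_admissible (mu eta : R) :
  0 < mu -> 0 < eta <= PI / 2 -> admissible_M mu (pursuit eta).
Proof.
  intros Hmu Heta. split; [|split].
  - intros x. apply pursuit_bounds. lra.
  - intros r theta. unfold pursuit, sgn_sin; simpl.
    rewrite cos_plus, sin_plus, cos_2PI, sin_2PI.
    now rewrite !Rmult_0_r, !Rmult_1_r, Rminus_0_r, Rplus_0_r.
  - intros [r0 th0] p _ Hr _ Hp. now apply pursuit_motion_exists.
Qed.

(** * L's strategy *)

Lemma first_hit_zero (f : R -> R) (a b : R) :
  a <= b -> cont_on a b f -> 0 <= f a -> f b <= 0 ->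
  exists t, a <= t <= b /\ f t = 0 /\ forall u, a <= u < t -> 0 < f u.
Proof.
  intros Hab Hf Ha Hb.
  destruct (first_hit f a b Hab Hf Hb) as [t [Ht [H0 H1]]].
  exists t. split; [assumption|]. split; [|assumption].
  destruct (Rle_lt_or_eq_dec _ _ H0) as [Hn|]; [exfalso|assumption].
  assert (Hta : a < t).
  { destruct (Rle_lt_or_eq_dec a t (proj1 Ht)) as [|E]; [assumption|subst; lra]. }
  destruct (cont_on_eps a b f t (- f t) Hf) as [d [Hd Hc]]; [lra|lra|].
  set (u := Rmax a (t - d / 2)).
  assert (Hu : a <= u < t /\ t - d / 2 <= u).
  { unfold u. pose proof (Rmax_l a (t - d / 2)). pose proof (Rmax_r a (t - d / 2)).
    split; [split; [assumption|apply Rmax_lub_lt; lra]|assumption]. }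
  assert (H : Rabs (f u - f t) < - f t).
  { apply Hc; [lra|]. apply Rabs_def1; lra. }
  apply Rabs_def2 in H. specialize (H1 u). lra.
Qed.

Lemma asin_above (y : R) : 1 <= y -> asin y = PI / 2.
Proof.
  intros Hy. unfold asin.
  destruct (Rle_dec y (-1)); [lra|]. destruct (Rle_dec 1 y); [reflexivity|lra].
Qed.

Lemma is_derive_asin (y : R) :
  -1 < y < 1 -> is_derive asin y (/ sqrt (1 - y ^ 2)).
Proof.
  intros Hy. apply is_derive_Reals.
  pose proof (derive_pt_asin y Hy) as H.
  apply derive_pt_eq_1 in H.
  replace (/ sqrt (1 - y ^ 2)) with (1 / sqrt (1 - y²)); [exact H|].
  unfold Rsqr, Rdiv. rewrite Rmult_1_l. do 3 f_equal. ring.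
Qed.

(** For [k = sin s], the heading of the straight swim that is tangent, at
    radius [mu * k], to the trajectory of L along the focal line; the value at
    radius at most [mu * k ^ 2] is [PI / 2] because [asin] is [PI / 2] above 1. *)
Definition approach_heading (mu k r : R) : R :=
  if Rlt_dec r (mu * k) then asin (mu * k ^ 2 / r) else PI / 2.

(** For [r > mu], which is never reached in the plays considered, any heading
    that does not block the game would do. *)
Definition opposition (mu k : R) : strategy_L := fun x w =>
  if Rlt_dec mu (fst x) then PI
  else if Req_EM_T (cos (snd x)) (-1) then asin (fst x * w / mu)
  else sgn_sin (snd x) * approach_heading mu k (fst x).

Lemma opposition_antipodal (mu k r theta w : R) :
  r <= mu -> cos theta = -1 -> opposition mu k (r, theta) w = asin (r * w / mu).
Proof.
  intros Hr Hc. unfold opposition; simpl.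
  destruct (Rlt_dec mu r); [lra|]. destruct (Req_EM_T (cos theta) (-1)); [reflexivity|tauto].
Qed.

Lemma opposition_off (mu k r theta w : R) :
  r <= mu -> cos theta <> -1 ->
  opposition mu k (r, theta) w = sgn_sin theta * approach_heading mu k r.
Proof.
  intros Hr Hc. unfold opposition; simpl.
  destruct (Rlt_dec mu r); [lra|]. destruct (Req_EM_T (cos theta) (-1)); [tauto|reflexivity].
Qed.

Lemma approach_heading_bound (mu k r : R) :
  - (PI / 2) <= approach_heading mu k r <= PI / 2.
Proof.
  unfold approach_heading. pose proof PI_RGT_0.
  destruct (Rlt_dec r (mu * k)); [apply asin_bound|lra].
Qed.

Lemma opposition_bound (mu k : R) (x : state) (w : R) :
  fst x <= mu -> - (PI / 2) <= opposition mu k x w <= PI / 2.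
Proof.
  intros Hr. unfold opposition.
  destruct (Rlt_dec mu (fst x)); [lra|].
  destruct (Req_EM_T (cos (snd x)) (-1)); [apply asin_bound|].
  pose proof (approach_heading_bound mu k (fst x)).
  destruct (sgn_sin_cases (snd x)) as [[-> _]|[-> _]]; lra.
Qed.

Lemma approach_heading_turn (mu k r : R) :
  0 < r <= mu -> 0 <= k -> 1 <= mu / r * sin (approach_heading mu k r).
Proof.
  intros Hr Hk. unfold approach_heading.
  assert (H1 : 1 <= mu / r).
  { apply Rmult_le_reg_r with r; [lra|]. replace (mu / r * r) with mu by (field; lra). lra. }
  destruct (Rlt_dec r (mu * k)) as [Hlt|]; [|rewrite sin_PI2; lra].
  assert (Hpos : 0 <= mu * k ^ 2 / r).
  { apply Rdiv_le_0_compat; [|lra]. apply Rmult_le_pos; [lra|apply pow2_ge_0]. }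
  destruct (Rle_dec (mu * k ^ 2 / r) 1) as [Hle|Hgt].
  - rewrite sin_asin by lra.
    replace (mu / r * (mu * k ^ 2 / r)) with ((mu * k / r) ^ 2) by (field; lra).
    assert (1 <= mu * k / r).
    { apply Rmult_le_reg_r with r; [lra|].
      replace (mu * k / r * r) with (mu * k) by (field; lra). lra. }
    nra.
  - rewrite asin_above by lra. rewrite sin_PI2. lra.
Qed.

Lemma cos_sgn_mult (e u : R) : e = 1 \/ e = -1 -> cos (e * u) = cos u.
Proof.
  intros [-> | ->]; [f_equal; ring|]. rewrite <- cos_neg. f_equal. ring.
Qed.

Lemma sin_sgn_mult (e u : R) : e = 1 \/ e = -1 -> sin (e * u) = e * sin u.
Proof.
  intros [-> | ->]; [rewrite !Rmult_1_l; reflexivity|].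
  replace (-1 * u) with (- u) by ring. rewrite sin_neg. ring.
Qed.

Lemma motion_against_constant_turn (mu k w d : R) (rho th : R -> R) :
  0 < mu -> -1 <= w <= 1 -> 0 < d ->
  (forall t, 0 <= t <= d -> 0 < rho t /\ ex_derive rho t /\ ex_derive th t) ->
  (forall t, 0 < t < d ->
     is_derive rho t (r_rate mu (opposition mu k (rho t, th t) w)) /\
     is_derive th t (theta_rate mu (rho t) (opposition mu k (rho t, th t) w) w)) ->
  exists (delta : R) (x : R -> state) (psi : R -> R),
    0 < delta /\ x 0 = (rho 0, th 0) /\ motion mu delta x psi (fun _ => w) /\
    follows_L (opposition mu k) delta x psi (fun _ => w).
Proof.
  intros Hmu Hw Hd H1 H2. pose proof PI_RGT_0.
  exists d, (fun t => (rho t, th t)), (fun t => opposition mu k (rho t, th t) w).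
  split; [assumption|]. split; [reflexivity|]. split; [|intros t _; reflexivity].
  split; [lra|]. split.
  - intros t Ht. destruct (H1 t Ht) as [Hr _].
    split; [simpl; lra|]. split.
    { destruct (Rle_dec (rho t) mu) as [Hle|Hgt].
      - pose proof (opposition_bound mu k (rho t, th t) w Hle). lra.
      - unfold opposition; simpl. destruct (Rlt_dec mu (rho t)); lra. }
    split; [assumption|]. split; [|intros _].
    + apply (cont_on_derive 0 d rho); [|exact Ht]. intros s Hs. apply (H1 s Hs).
    + apply (cont_on_derive 0 d th); [|exact Ht]. intros s Hs. apply (H1 s Hs).
  - exists nil. intros t Ht _. destruct (H1 t) as [Hr _]; [lra|].
    split; [assumption|]. exact (H2 t Ht).
Qed.

Lemma approach_path (mu k r0 : R) :
  0 < mu -> 0 <= k <= 1 -> 0 < r0 <= mu ->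
  exists (d : R) (rho alpha : R -> R),
    0 < d /\ rho 0 = r0 /\ alpha 0 = 0 /\
    forall t, 0 <= t <= d ->
      0 < rho t <= mu /\
      is_derive rho t (mu * cos (approach_heading mu k (rho t))) /\
      is_derive alpha t (mu / rho t * sin (approach_heading mu k (rho t))).
Proof.
  intros Hmu Hk Hr0.
  assert (Hcirc : approach_heading mu k r0 = PI / 2 ->
    exists (d : R) (rho alpha : R -> R),
    0 < d /\ rho 0 = r0 /\ alpha 0 = 0 /\
    forall t, 0 <= t <= d ->
      0 < rho t <= mu /\
      is_derive rho t (mu * cos (approach_heading mu k (rho t))) /\
      is_derive alpha t (mu / rho t * sin (approach_heading mu k (rho t)))).
  { intros E. exists 1, (fun _ => r0), (fun t => mu / r0 * t).
    split; [lra|]. split; [reflexivity|]. split; [ring|].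
    intros t Ht. rewrite E, cos_PI2, sin_PI2.
    split; [assumption|]. split; auto_derive; trivial; ring. }
  destruct (Rlt_dec r0 (mu * k)) as [Hlt|Hge].
  2:{ apply Hcirc. unfold approach_heading. destruct (Rlt_dec r0 (mu * k)); [lra|reflexivity]. }
  set (h := mu * k ^ 2).
  destruct (Rle_dec r0 h) as [Hle|Hgt].
  { apply Hcirc. unfold approach_heading. destruct (Rlt_dec r0 (mu * k)); [|lra].
    apply asin_above. apply Rmult_le_reg_r with r0; [lra|].
    fold h. replace (h / r0 * r0) with h by (field; lra). lra. }
  assert (Hk0 : 0 < k) by nra.
  assert (Hh : 0 < h) by (apply Rmult_lt_0_compat; [lra|apply pow_lt; lra]).
  set (q0 := sqrt (r0 ^ 2 - h ^ 2)).
  assert (Hq0 : 0 < q0) by (apply sqrt_lt_R0; nra).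
  assert (Hq2 : q0 * q0 = r0 ^ 2 - h ^ 2) by (apply sqrt_sqrt; nra).
  set (q := fun t => q0 + mu * t).
  set (rho := fun t => sqrt (h ^ 2 + q t ^ 2)).
  assert (Hin : forall t, 0 < h ^ 2 + q t ^ 2).
  { intros t. pose proof (pow2_ge_0 (q t)). assert (0 < h ^ 2) by (apply pow_lt; lra). lra. }
  assert (Hr2 : forall t, rho t * rho t = h ^ 2 + q t ^ 2).
  { intros t. apply sqrt_sqrt. apply Rlt_le, Hin. }
  assert (Hrpos : forall t, 0 < rho t) by (intros; apply sqrt_lt_R0, Hin).
  assert (Hdrho : forall t, is_derive rho t (mu * (q t / rho t))).
  { intros t. unfold rho, q. auto_derive.
    - specialize (Hin t). unfold q in Hin. simpl in *. lra.
    - specialize (Hrpos t). unfold rho, q in Hrpos. simpl in *. field. lra. }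
  assert (Hrho0 : rho 0 = r0).
  { unfold rho, q. rewrite Rmult_0_r, Rplus_0_r.
    replace (h ^ 2 + q0 ^ 2) with (r0 * r0) by (simpl in *; lra).
    apply sqrt_square. lra. }
  destruct (continuous_pos_interval (fun t => mu * k - rho t) 0) as [d [Hd Hpos]].
  { apply (continuous_minus (V := R_NormedModule) (fun _ => mu * k));
      [apply continuous_const|].
    apply (ex_derive_continuous (V := R_NormedModule)). eexists; apply Hdrho. }
  { lra. }
  exists d, rho, (fun t => atan (q t / h) - atan (q0 / h)).
  split; [assumption|]. split; [assumption|].
  split; [unfold q; rewrite Rmult_0_r, Rplus_0_r; ring|].
  intros t Ht.
  assert (Hrk : rho t < mu * k) by (specialize (Hpos t); lra).
  specialize (Hrpos t). specialize (Hr2 t).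
  assert (Hqt : 0 < q t) by (unfold q; nra).
  assert (Hhr : 0 < h / rho t < 1).
  { split; [apply Rdiv_lt_0_compat; lra|].
    apply Rmult_lt_reg_r with (rho t); [lra|].
    replace (h / rho t * rho t) with h by (field; lra). nra. }
  assert (Hhead : approach_heading mu k (rho t) = asin (h / rho t)).
  { unfold approach_heading. destruct (Rlt_dec (rho t) (mu * k)); [reflexivity|lra]. }
  rewrite Hhead, sin_asin, cos_asin by lra.
  split; [split; [lra|nra]|]. split.
  - replace (sqrt (1 - (h / rho t)²)) with (q t / rho t); [apply Hdrho|].
    replace (1 - (h / rho t)²) with ((q t / rho t) * (q t / rho t)).
    + rewrite sqrt_square; [reflexivity|]. apply Rlt_le, Rdiv_lt_0_compat; lra.
    + unfold Rsqr. replace (1 - h / rho t * (h / rho t))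
        with ((rho t * rho t - h ^ 2) / (rho t * rho t)) by (field; lra).
      rewrite Hr2 at 1. field. lra.
  - replace (mu / rho t * (h / rho t)) with (mu * h / (rho t * rho t)) by (field; lra).
    rewrite Hr2. unfold q in *. auto_derive; [trivial|].
    field. simpl in *. split; [|lra].
    intros E. nra.
Qed.

Lemma opposition_motion_exists (mu k w r0 th0 : R) :
  0 < mu -> 0 <= k <= 1 -> -1 <= w <= 1 -> 0 < r0 ->
  (cos th0 = -1 -> r0 <> mu) ->
  exists (delta : R) (x : R -> state) (psi : R -> R),
    0 < delta /\ x 0 = (r0, th0) /\ motion mu delta x psi (fun _ => w) /\
    follows_L (opposition mu k) delta x psi (fun _ => w).
Proof.
  intros Hmu Hk Hw Hr0 HE. pose proof PI_RGT_0 as HPI.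
  destruct (Rlt_dec mu r0) as [Hout|Hin].
  { replace (r0, th0) with (r0 - mu * 0, th0 - w * 0) by (f_equal; ring).
    assert (Hd : 0 < (r0 - mu) / (2 * mu)) by (apply Rdiv_lt_0_compat; lra).
    assert (Hrho : forall t, 0 <= t <= (r0 - mu) / (2 * mu) -> mu < r0 - mu * t).
    { intros t [Ht0 Ht]. apply (Rmult_le_compat_l mu) in Ht; [|lra].
      replace (mu * ((r0 - mu) / (2 * mu))) with ((r0 - mu) / 2) in Ht by (field; lra).
      lra. }
    apply (motion_against_constant_turn mu k w ((r0 - mu) / (2 * mu))
             (fun t => r0 - mu * t) (fun t => th0 - w * t)); auto.
    - intros t Ht. specialize (Hrho t Ht). split; [lra|].
      split; auto_derive; trivial.
    - intros t Ht. assert (mu < r0 - mu * t) by (apply Hrho; lra).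
      unfold opposition; simpl. destruct (Rlt_dec mu (r0 - mu * t)); [|lra].
      unfold r_rate, theta_rate. rewrite cos_PI, sin_PI.
      split; auto_derive; trivial; ring. }
  destruct (Req_EM_T (cos th0) (-1)) as [Ha|Hna].
  { assert (Hlt : r0 < mu) by (specialize (HE Ha); lra).
    assert (Hr0mu : 0 < r0 / mu < 1).
    { split; [apply Rdiv_lt_0_compat; lra|].
      apply Rmult_lt_reg_r with mu; [lra|].
      replace (r0 / mu * mu) with r0 by (field; lra). lra. }
    assert (Hrw : -1 < r0 * w / mu < 1).
    { replace (r0 * w / mu) with (r0 / mu * w) by (field; lra). split; nra. }
    set (c := asin (r0 * w / mu)).
    assert (Hc : - (PI / 2) < c < PI / 2) by (apply asin_bound_lt; assumption).
    assert (Hsc : sin c = r0 * w / mu) by (apply sin_asin; lra).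
    assert (Hrho : exists rho : R -> R, rho 0 = r0 /\
       (forall t, is_derive rho t (mu * cos (w * t + c))) /\
       (forall t, rho t * w / mu = sin (w * t + c))).
    { destruct (Req_EM_T w 0) as [Hw0|Hw0].
      - exists (fun t => r0 + mu * cos c * t). split; [ring|]. split.
        + intros t. rewrite Hw0. replace (0 * t + c) with c by ring.
          auto_derive; [trivial|ring].
        + intros t. rewrite Hw0 in *. replace (0 * t + c) with c by ring.
          rewrite Hsc. unfold Rdiv. ring.
      - exists (fun t => mu / w * sin (w * t + c)). split.
        + rewrite Rmult_0_r, Rplus_0_l, Hsc. field. lra.
        + split; intros t; [auto_derive; [trivial|]|]; field; lra. }
    destruct Hrho as [rho [Hrho0 [Hdrho Hrhow]]].
    assert (Hcr : continuous rho 0).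
    { apply (ex_derive_continuous (V := R_NormedModule)). eexists; apply Hdrho. }
    destruct (continuous_pos_interval rho 0 Hcr) as [d1 [Hd1 H1]]; [lra|].
    destruct (continuous_pos_interval (fun t => mu - rho t) 0) as [d2 [Hd2 H2]];
      [|lra|].
    { apply (continuous_minus (V := R_NormedModule) (fun _ => mu));
        [apply continuous_const|assumption]. }
    destruct (continuous_pos_interval (fun t => PI / 2 - (w * t + c)) 0)
      as [d3 [Hd3 H3]]; [|lra|].
    { apply (ex_derive_continuous (V := R_NormedModule)). auto_derive. trivial. }
    destruct (continuous_pos_interval (fun t => (w * t + c) + PI / 2) 0)
      as [d4 [Hd4 H4]]; [|lra|].
    { apply (ex_derive_continuous (V := R_NormedModule)). auto_derive. trivial. }
    set (d := Rmin (Rmin d1 d2) (Rmin d3 d4)).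
    assert (Hd : 0 < d) by (unfold d; repeat apply Rmin_glb_lt; assumption).
    assert (Hdl : d <= d1 /\ d <= d2 /\ d <= d3 /\ d <= d4).
    { pose proof (Rmin_l (Rmin d1 d2) (Rmin d3 d4)).
      pose proof (Rmin_r (Rmin d1 d2) (Rmin d3 d4)).
      pose proof (Rmin_l d1 d2). pose proof (Rmin_r d1 d2).
      pose proof (Rmin_l d3 d4). pose proof (Rmin_r d3 d4). fold d in H, H0. lra. }
    rewrite <- Hrho0.
    apply (motion_against_constant_turn mu k w d rho (fun _ => th0)); auto.
    - intros t Ht. split; [apply H1; lra|]. split; [eexists; apply Hdrho|].
      auto_derive. trivial.
    - intros t Ht. specialize (H1 t). specialize (H2 t). specialize (H3 t).
      specialize (H4 t).
      rewrite opposition_antipodal by (assumption || lra).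
      rewrite Hrhow, asin_sin by lra.
      unfold r_rate, theta_rate. split; [apply Hdrho|].
      rewrite <- Hrhow. replace (mu / rho t * (rho t * w / mu) - w) with 0 by (field; lra).
      auto_derive; trivial. }
  destruct (approach_path mu k r0) as [d0 [rho [alpha [Hd0 [Hrho0 [Ha0 Hpath]]]]]];
    [lra|lra|lra|].
  set (e := sgn_sin th0).
  assert (He : e = 1 \/ e = -1).
  { unfold e. destruct (sgn_sin_cases th0) as [[-> _]|[-> _]]; auto. }
  set (th := fun t => th0 + e * alpha t - w * t).
  assert (Hdth : forall t, 0 <= t <= d0 -> is_derive th t
     (e * (mu / rho t * sin (approach_heading mu k (rho t))) - w)).
  { intros t Ht. destruct (Hpath t Ht) as [_ [_ Hda]]. unfold th. evar_last.
    - auto_derive; [repeat split; eexists; exact Hda|reflexivity].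
    - change (Derive (fun x => alpha x) t) with (Derive alpha t).
      rewrite (is_derive_unique _ _ _ Hda). ring. }
  assert (Hth0 : th 0 = th0) by (unfold th; rewrite Ha0; ring).
  assert (Hcth : continuous th 0).
  { apply (ex_derive_continuous (V := R_NormedModule)). eexists. apply Hdth. lra. }
  assert (Hside : exists d, 0 < d /\ d <= d0 /\ forall t, 0 < t < d ->
            cos (th t) <> -1 /\ sgn_sin (th t) = e).
  { destruct (Req_EM_T (sin th0) 0) as [Hs0|Hs0].
    - assert (Hc1 : cos th0 = 1).
      { pose proof (sin2_cos2 th0) as Hsc. rewrite Hs0 in Hsc. unfold Rsqr in Hsc.
        assert ((cos th0 - 1) * (cos th0 + 1) = 0) by lra.
        apply Rmult_integral in H. lra. }
      assert (He1 : e = 1).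
      { unfold e. destruct (sgn_sin_cases th0) as [[-> _]|[_ Hneg]]; lra. }
      destruct (continuous_pos_interval (fun t => cos (th t)) 0) as [d1 [Hd1 H1]].
      { apply (continuous_comp th cos); [assumption|apply continuous_cos]. }
      { rewrite Hth0, Hc1. lra. }
      destruct (continuous_pos_interval (fun t => PI - (th t - th0)) 0) as [d2 [Hd2 H2]].
      { apply (continuous_minus (V := R_NormedModule) (fun _ => PI));
          [apply continuous_const|].
        apply (continuous_minus (V := R_NormedModule) th (fun _ => th0));
          [assumption|apply continuous_const]. }
      { rewrite Hth0. lra. }
      set (d := Rmin d0 (Rmin d1 d2)).
      assert (Hd : 0 < d) by (unfold d; repeat apply Rmin_glb_lt; assumption).
      assert (Hdl : d <= d0 /\ d <= d1 /\ d <= d2).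
      { unfold d. pose proof (Rmin_l d0 (Rmin d1 d2)).
        pose proof (Rmin_r d0 (Rmin d1 d2)).
        pose proof (Rmin_l d1 d2). pose proof (Rmin_r d1 d2). lra. }
      exists d. split; [assumption|]. split; [lra|]. intros t Ht.
      specialize (H1 t). specialize (H2 t).
      split; [lra|].
      assert (Hup : th 0 <= th t).
      { apply (nondecreasing_derive nil); [lra| |].
        - apply cont_on_derive. intros u Hu. eexists. apply Hdth. lra.
        - intros u Hu _. eexists. split; [apply Hdth; lra|].
          destruct (Hpath u) as [Hru _]; [lra|].
          pose proof (approach_heading_turn mu k (rho u) Hru (proj1 Hk)).
          rewrite He1. lra. }
      rewrite He1. unfold sgn_sin.
      destruct (Rle_dec 0 (sin (th t))) as [|Hn]; [reflexivity|exfalso; apply Hn].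
      replace (th t) with (th0 + (th t - th0)) by ring.
      rewrite sin_plus, Hs0, Hc1.
      assert (0 <= sin (th t - th0)) by (apply sin_ge_0; lra). lra.
    - destruct (continuous_pos_interval (fun t => e * sin (th t)) 0) as [d1 [Hd1 H1]].
      { apply (continuous_mult (K := R_AbsRing) (fun _ => e));
          [apply continuous_const|].
        apply (continuous_comp th sin); [assumption|apply continuous_sin]. }
      { rewrite Hth0. unfold e.
        destruct (sgn_sin_cases th0) as [[-> ?]|[-> ?]]; lra. }
      exists (Rmin d0 d1). split; [apply Rmin_glb_lt; assumption|].
      pose proof (Rmin_l d0 d1). pose proof (Rmin_r d0 d1).
      split; [assumption|]. intros t Ht.
      assert (Hst : 0 < e * sin (th t)) by (apply H1; lra).
      split.
      + intros Ec. pose proof (sin2_cos2 (th t)) as Hsc. rewrite Ec in Hsc.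
        unfold Rsqr in Hsc. assert (sin (th t) = 0) by nra. nra.
      + destruct (sgn_sin_cases (th t)) as [[-> ?]|[-> ?]];
          destruct He as [E|E]; rewrite E in *; lra. }
  destruct Hside as [d [Hd [Hdd Hside]]].
  rewrite <- Hrho0, <- Hth0.
  apply (motion_against_constant_turn mu k w d rho th); auto.
  - intros t Ht. destruct (Hpath t) as [Hr [Hdr _]]; [lra|].
    split; [apply Hr|]. split; [eexists; exact Hdr|]. eexists; apply Hdth; lra.
  - intros t Ht. destruct (Hpath t) as [Hr [Hdr _]]; [lra|].
    destruct (Hside t Ht) as [Hc Hs].
    rewrite (opposition_off mu k _ _ _ (proj2 Hr) Hc), Hs.
    unfold r_rate, theta_rate. rewrite cos_sgn_mult, sin_sgn_mult by assumption.
    split; [exact Hdr|].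
    replace (mu / rho t * (e * sin (approach_heading mu k (rho t))))
      with (e * (mu / rho t * sin (approach_heading mu k (rho t)))) by ring.
    apply Hdth. lra.
Qed.

Lemma opposition_admissible (mu k : R) :
  0 < mu -> 0 <= k <= 1 -> admissible_L mu (opposition mu k).
Proof.
  intros Hmu Hk. pose proof PI_RGT_0. split; [|split; [|split]].
  - intros x w. destruct (Rle_dec (fst x) mu) as [Hle|Hgt].
    + pose proof (opposition_bound mu k x w Hle). lra.
    + unfold opposition. destruct (Rlt_dec mu (fst x)); lra.
  - intros r theta w. unfold opposition, sgn_sin; simpl.
    rewrite cos_plus, sin_plus, cos_2PI, sin_2PI.
    now rewrite !Rmult_0_r, !Rmult_1_r, Rminus_0_r, Rplus_0_r.
  - intros x w w' Hx. unfold antipodal in Hx. unfold opposition.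
    destruct (Rlt_dec mu (fst x)); [reflexivity|].
    destruct (Req_EM_T (cos (snd x)) (-1)); [tauto|reflexivity].
  - intros [r0 th0] w _ Hr HE Hw. apply opposition_motion_exists; auto.
    intros Hc Er. apply HE. split; assumption.
Qed.

Lemma is_derive_cos_comp (th : R -> R) (t l : R) :
  is_derive th t l -> is_derive (fun u => cos (th u)) t (- sin (th t) * l).
Proof.
  intros H. evar_last; [auto_derive; [eexists; exact H|reflexivity]|].
  change (Derive (fun u => th u) t) with (Derive th t).
  rewrite (is_derive_unique _ _ _ H). ring.
Qed.

Lemma is_derive_asin_minus_id (y : R -> R) (t l : R) :
  -1 < y t < 1 -> is_derive y t l ->
  is_derive (fun u => asin (y u) - u) t (/ sqrt (1 - y t ^ 2) * l - 1).
Proof.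
  intros Hy H. apply (is_derive_minus (V := R_NormedModule)).
  - replace (/ sqrt (1 - y t ^ 2) * l) with (scal l (/ sqrt (1 - y t ^ 2)))
      by (apply Rmult_comm).
    apply (is_derive_comp (V := R_NormedModule) asin y); [|exact H].
    now apply is_derive_asin.
  - apply (is_derive_id (K := R_AbsRing)).
Qed.

Lemma is_derive_div_const (y : R -> R) (t l c : R) :
  is_derive y t l -> is_derive (fun u => y u / c) t (l / c).
Proof.
  intros H. evar_last; [auto_derive; [eexists; exact H|reflexivity]|].
  change (Derive (fun u => y u) t) with (Derive y t).
  rewrite (is_derive_unique _ _ _ H). unfold Rdiv. ring.
Qed.

Lemma opposition_radius_nondecreasing (mu k T a b : R) (x : R -> state)
    (psi omega : R -> R) :
  0 < mu -> motion mu T x psi omega -> follows_L (opposition mu k) T x psi omega ->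
  0 <= a <= b -> b <= T -> (forall t, a < t < b -> fst (x t) <= mu) ->
  fst (x a) <= fst (x b).
Proof.
  intros Hmu Hm Hf Hab HbT Hr. pose proof Hm as [_ [_ [L HL]]].
  apply (nondecreasing_derive L (fun t => fst (x t))); [lra| |].
  - apply (cont_on_subset 0 T); [lra|lra|]. exact (motion_fst_cont _ _ _ _ _ Hm).
  - intros t Ht HtL. destruct (HL t) as [_ [Hd _]]; [lra|assumption|].
    eexists. split; [exact Hd|]. unfold r_rate.
    rewrite (Hf t) by lra.
    pose proof (opposition_bound mu k (x t) (omega t) (Hr t Ht)).
    apply Rmult_le_pos; [lra|]. apply cos_ge_0; lra.
Qed.

Lemma opposition_cos_nonincreasing (mu k T a b : R) (x : R -> state)
    (psi omega : R -> R) :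
  0 < mu -> 0 <= k ->
  motion mu T x psi omega -> follows_L (opposition mu k) T x psi omega ->
  0 <= a <= b -> b <= T -> (forall t, a <= t <= b -> 0 < fst (x t) <= mu) ->
  cos (snd (x b)) <= cos (snd (x a)).
Proof.
  intros Hmu Hk Hm Hf Hab HbT Hr. pose proof Hm as [_ [Hm1 [L HL]]].
  apply (nonincreasing_derive L (fun t => cos (snd (x t)))); [lra| |].
  - apply (cont_on_comp a b (fun t => snd (x t)) cos).
    + apply (motion_snd_cont _ _ _ _ _ _ _ Hm); [lra|lra|]. intros t Ht. apply (Hr t Ht).
    + intros; apply continuous_cos.
  - intros t Ht HtL. destruct (HL t) as [_ [_ Hd]]; [lra|assumption|].
    exists (- sin (snd (x t)) * theta_rate mu (fst (x t)) (psi t) (omega t)). split.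
    { exact (is_derive_cos_comp (fun u => snd (x u)) t _ Hd). }
    destruct (Hr t) as [Hr0 Hrmu]; [lra|].
    destruct (Hm1 t) as [_ [_ [Hw _]]]; [lra|].
    destruct (Req_EM_T (cos (snd (x t))) (-1)) as [Hc|Hc].
    { pose proof (sin2_cos2 (snd (x t))) as Hsc. rewrite Hc in Hsc. unfold Rsqr in Hsc.
      assert (Hs : sin (snd (x t)) = 0) by nra. rewrite Hs. lra. }
    rewrite (Hf t) by lra.
    rewrite (surjective_pairing (x t)) at 3.
    rewrite opposition_off by assumption.
    pose proof (approach_heading_turn mu k (fst (x t)) (conj Hr0 Hrmu) Hk) as Hturn.
    unfold theta_rate. set (X := mu / fst (x t)) in *.
    destruct (sgn_sin_cases (snd (x t))) as [[-> Hs]|[-> Hs]].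
    + rewrite Rmult_1_l. nra.
    + replace (-1 * approach_heading mu k (fst (x t)))
        with (- approach_heading mu k (fst (x t))) by ring.
      rewrite sin_neg. nra.
Qed.

Lemma opposition_stays_antipodal (mu k T a b : R) (x : R -> state)
    (psi omega : R -> R) :
  0 < mu -> 0 <= k ->
  motion mu T x psi omega -> follows_L (opposition mu k) T x psi omega ->
  0 <= a <= b -> b <= T -> (forall t, a <= t <= b -> 0 < fst (x t) <= mu) ->
  cos (snd (x a)) = -1 -> cos (snd (x b)) = -1.
Proof.
  intros Hmu Hk Hm Hf Hab HbT Hr Hc.
  pose proof (opposition_cos_nonincreasing mu k T a b x psi omega Hmu Hk Hm Hf
    Hab HbT Hr).
  pose proof (COS_bound (snd (x b))). lra.
Qed.

Lemma opposition_reaches_E_from_antipodal (mu k T a : R) (x : R -> state)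
    (psi omega : R -> R) :
  0 < mu -> 0 <= k ->
  motion mu T x psi omega -> follows_L (opposition mu k) T x psi omega ->
  0 <= a -> 0 < fst (x a) <= mu -> cos (snd (x a)) = -1 ->
  a + acos (fst (x a) / mu) <= T ->
  exists t, a <= t <= a + acos (fst (x a) / mu) /\ at_E mu (x t) /\
    forall s, a <= s <= t -> 0 <= fst (x s) <= mu.
Proof.
  intros Hmu Hk Hm Hf Ha Hra Hca HT.
  set (b := a + acos (fst (x a) / mu)) in *.
  assert (Hab : a <= b) by (pose proof (acos_bound (fst (x a) / mu)); unfold b; lra).
  assert (Hcr : cont_on a b (fun t => fst (x t))).
  { apply (cont_on_subset 0 T); [lra|lra|]. exact (motion_fst_cont _ _ _ _ _ Hm). }
  assert (Hbelow : forall c, a <= c <= b -> (forall t, a <= t < c -> fst (x t) < mu) ->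
            fst (x c) <= mu -> forall t, a <= t <= c -> 0 < fst (x t) <= mu).
  { intros c Hc Hlt Hle t Ht.
    assert (fst (x a) <= fst (x t)).
    { apply (opposition_radius_nondecreasing mu k T a t x psi omega); auto; [lra|lra|].
      intros u Hu. apply Rlt_le, Hlt. lra. }
    split; [lra|]. destruct (Rle_lt_or_eq_dec t c (proj2 Ht)) as [Htc| ->];
      [apply Rlt_le, Hlt; lra|assumption]. }
  destruct (classic (exists c, a <= c <= b /\ mu <= fst (x c))) as [[c [Hc Hge]]|Hn].
  - destruct (first_hit_zero (fun t => mu - fst (x t)) a c) as [t [Ht [H0 H1]]].
    { lra. }
    { apply cont_on_minus; [apply cont_on_const|].
      apply (cont_on_subset a b); [lra|lra|assumption]. }
    { lra. }
    { lra. }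
    assert (Hall : forall s, a <= s <= t -> 0 < fst (x s) <= mu).
    { apply Hbelow; [lra| |lra]. intros u Hu. specialize (H1 u Hu). lra. }
    exists t. split; [lra|]. split; [split; [lra|]|].
    + apply (opposition_stays_antipodal mu k T a t x psi omega); auto; lra.
    + intros s Hs. specialize (Hall s Hs). lra.
  - exfalso.
    assert (Hlt : forall t, a <= t <= b -> fst (x t) < mu).
    { intros t Ht. apply Rnot_le_lt. intros Hle. apply Hn. exists t. lra. }
    assert (Hall : forall t, a <= t <= b -> 0 < fst (x t) <= mu).
    { apply Hbelow; [lra| |].
      - intros t Ht. apply Hlt. lra.
      - apply Rlt_le, Hlt. lra. }
    assert (Hy : forall t, a <= t <= b -> 0 < fst (x t) / mu < 1).
    { intros t Ht. specialize (Hall t Ht). specialize (Hlt t Ht).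
      split; [apply Rdiv_lt_0_compat; lra|].
      apply Rmult_lt_reg_r with mu; [lra|].
      replace (fst (x t) / mu * mu) with (fst (x t)) by (field; lra). lra. }
    pose proof Hm as [_ [Hm1 [L HL]]].
    assert (Hmon : asin (fst (x a) / mu) - a <= asin (fst (x b) / mu) - b).
    { apply (nondecreasing_derive L (fun t => asin (fst (x t) / mu) - t)); [lra| |].
      - apply cont_on_minus; [|apply cont_on_derive; intros; auto_derive; trivial].
        apply (cont_on_comp a b (fun t => fst (x t) / mu) asin).
        + apply cont_on_mult; [assumption|apply cont_on_const].
        + intros t Ht. apply (ex_derive_continuous (V := R_NormedModule)).
          eexists. apply is_derive_asin. specialize (Hy t Ht). lra.
      - intros t Ht HtL. destruct (HL t) as [_ [Hd _]]; [lra|assumption|].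
        assert (Ht' : a <= t <= b) by lra.
        specialize (Hy t Ht'). specialize (Hall t Ht').
        destruct (Hm1 t) as [_ [_ [Hw _]]]; [lra|].
        assert (Hct : cos (snd (x t)) = -1).
        { apply (opposition_stays_antipodal mu k T a t x psi omega); auto; [lra|lra|].
          intros u Hu. assert (Hu' : a <= u <= b) by lra.
          apply Hbelow with (c := b); [lra| | |assumption].
          - intros v Hv. apply Hlt. lra.
          - apply Rlt_le, Hlt. lra. }
        rewrite (Hf t), (surjective_pairing (x t)), opposition_antipodal in Hd by lra.
        set (y := fst (x t) / mu) in *.
        exists (/ sqrt (1 - y ^ 2) * (r_rate mu (asin (fst (x t) * omega t / mu)) / mu) - 1).
        split.
        + apply (is_derive_asin_minus_id (fun u => fst (x u) / mu)); [fold y; lra|].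
          exact (is_derive_div_const _ _ _ mu Hd).
        + unfold r_rate.
          replace (fst (x t) * omega t / mu) with (y * omega t) by (unfold y; field; lra).
          assert (Hyw : -1 <= y * omega t <= 1) by (split; nra).
          rewrite cos_asin by assumption.
          assert (Hs : 0 < sqrt (1 - y ^ 2)) by (apply sqrt_lt_R0; nra).
          assert (Hle : sqrt (1 - y ^ 2) <= sqrt (1 - (y * omega t)²)).
          { apply sqrt_le_1_alt. unfold Rsqr.
            assert (omega t * omega t <= 1) by nra.
            assert (0 <= y * y) by nra. nra. }
          replace (/ sqrt (1 - y ^ 2) * (mu * sqrt (1 - (y * omega t)²) / mu) - 1)
            with ((sqrt (1 - (y * omega t)²) - sqrt (1 - y ^ 2)) * / sqrt (1 - y ^ 2))
            by (field; lra).
          apply Rmult_le_pos; [lra|]. apply Rlt_le, Rinv_0_lt_compat, Hs. }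
    assert (Hya : 0 < fst (x a) / mu < 1) by (apply Hy; lra).
    assert (Hyb : 0 < fst (x b) / mu < 1) by (apply Hy; lra).
    pose proof (asin_bound_lt (fst (x b) / mu)) as Hlast.
    pose proof (acos_asin (fst (x a) / mu)) as Hco.
    unfold b in *. lra.
Qed.

(** * The tributaries *)

Definition entry_time (s : R) : R := sin s * cos s / 2.

(** In the fixed frame the tributary is a straight line: [mu * swim_coord] is the
    position of L along it, measured from the foot of the perpendicular from the
    center, at distance [mu * sin s ^ 2]. *)
Definition swim_coord (s t : R) : R := sin s * cos s - entry_time s + t.

Definition swim_radius (s t : R) : R := sqrt (sin s ^ 4 + swim_coord s t ^ 2).

Definition swim_angle (s t : R) : R :=
  PI / 2 + s + (entry_time s - t) + atan (swim_coord s t / sin s ^ 2).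

Lemma sin_cos_acute (s : R) : 0 < s < PI / 2 -> 0 < sin s < 1 /\ 0 < cos s < 1.
Proof.
  intros Hs. pose proof PI_RGT_0.
  assert (0 < sin s) by (apply sin_gt_0; lra).
  assert (0 < cos s) by (apply cos_gt_0; lra).
  pose proof (sin2_cos2 s) as Hsc. unfold Rsqr in Hsc. split; split; nra.
Qed.

Lemma entry_time_bounds (s : R) :
  0 < s < PI / 2 -> 0 < entry_time s < 1 / 2 /\ 2 * entry_time s = sin s * cos s.
Proof.
  intros Hs. destruct (sin_cos_acute s Hs) as [H1 H2].
  unfold entry_time. split; [split; nra|lra].
Qed.

Lemma swim_radius_sqr (s t : R) :
  swim_radius s t * swim_radius s t = sin s ^ 4 + swim_coord s t ^ 2.
Proof.
  apply sqrt_sqrt. pose proof (pow2_ge_0 (swim_coord s t)).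
  pose proof (pow2_ge_0 (sin s ^ 2)).
  replace (sin s ^ 4) with ((sin s ^ 2) ^ 2) by ring. lra.
Qed.

Lemma swim_radius_pos (s t : R) : 0 < s < PI / 2 -> 0 < swim_radius s t.
Proof.
  intros Hs. destruct (sin_cos_acute s Hs) as [H1 _]. apply sqrt_lt_R0.
  pose proof (pow2_ge_0 (swim_coord s t)).
  assert (0 < sin s ^ 4) by (apply pow_lt; lra). lra.
Qed.

Lemma swim_coord_pos (s t : R) :
  0 < s < PI / 2 -> - entry_time s < t -> 0 < swim_coord s t.
Proof.
  intros Hs Ht. destruct (entry_time_bounds s Hs). unfold swim_coord. lra.
Qed.

Lemma swim_radius_gt (s t : R) :
  0 < s < PI / 2 -> - entry_time s < t -> sin s ^ 2 < swim_radius s t.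
Proof.
  intros Hs Ht. pose proof (swim_coord_pos s t Hs Ht).
  pose proof (swim_radius_sqr s t). pose proof (swim_radius_pos s t Hs).
  pose proof (pow2_ge_0 (sin s)).
  replace (sin s ^ 4) with (sin s ^ 2 * sin s ^ 2) in * by ring. nra.
Qed.

Lemma swim_radius_sqr_gap (s t : R) :
  swim_radius s t * swim_radius s t =
  sin s ^ 2 - (sin s * cos s - swim_coord s t) * (sin s * cos s + swim_coord s t).
Proof.
  rewrite swim_radius_sqr. pose proof (sin2_cos2 s) as Hsc. unfold Rsqr in Hsc.
  replace (sin s ^ 4) with (sin s ^ 2 * (1 - cos s * cos s)); [ring|].
  replace (1 - cos s * cos s) with (sin s * sin s) by lra. ring.
Qed.

Lemma swim_radius_lt (s t : R) :
  0 < s < PI / 2 -> - entry_time s < t < entry_time s ->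
  swim_radius s t < sin s.
Proof.
  intros Hs Ht. destruct (sin_cos_acute s Hs) as [H1 H2].
  pose proof (swim_coord_pos s t Hs (proj1 Ht)).
  pose proof (swim_radius_sqr_gap s t). pose proof (swim_radius_pos s t Hs).
  assert (0 < sin s * cos s - swim_coord s t) by (unfold swim_coord; lra).
  assert (0 < sin s * cos s) by (apply Rmult_lt_0_compat; lra).
  assert (0 < (sin s * cos s - swim_coord s t) * (sin s * cos s + swim_coord s t))
    by (apply Rmult_lt_0_compat; lra).
  nra.
Qed.

Lemma swim_radius_entry (s : R) :
  0 < s < PI / 2 -> swim_radius s (entry_time s) = sin s.
Proof.
  intros Hs. destruct (sin_cos_acute s Hs) as [H1 H2].
  assert (E : swim_coord s (entry_time s) = sin s * cos s) by (unfold swim_coord; ring).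
  pose proof (swim_radius_sqr_gap s (entry_time s)) as H.
  pose proof (swim_radius_pos s (entry_time s) Hs).
  rewrite E in H. nra.
Qed.

Lemma swim_radius_le (s t : R) :
  0 < s < PI / 2 -> 0 <= t <= entry_time s -> swim_radius s t <= sin s.
Proof.
  intros Hs [H0 [Ht| ->]].
  - apply Rlt_le, swim_radius_lt; [assumption|]. pose proof (entry_time_bounds s Hs). lra.
  - right. now apply swim_radius_entry.
Qed.

Lemma is_derive_swim_radius (s t : R) :
  0 < s < PI / 2 ->
  is_derive (swim_radius s) t (swim_coord s t / swim_radius s t).
Proof.
  intros Hs. pose proof (swim_radius_sqr s t) as Hsq.
  pose proof (swim_radius_pos s t Hs) as Hp.
  unfold swim_radius, swim_coord in *. auto_derive.
  - simpl in *. nra.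
  - simpl in *. field. lra.
Qed.

Lemma is_derive_swim_angle (s t : R) :
  0 < s < PI / 2 ->
  is_derive (swim_angle s) t
    (sin s ^ 2 / (swim_radius s t * swim_radius s t) - 1).
Proof.
  intros Hs. destruct (sin_cos_acute s Hs) as [H1 _].
  pose proof (swim_radius_pos s t Hs) as Hp.
  pose proof (swim_radius_sqr s t) as Hsq.
  rewrite Hsq. unfold swim_angle, swim_coord in *. auto_derive; [trivial|].
  set (q := sin s * cos s - entry_time s + t) in *.
  replace (sin s * cos s + - entry_time s + t) with q by (unfold q; ring).
  assert (Hk : 0 < sin s ^ 4) by (apply pow_lt; lra).
  pose proof (pow2_ge_0 q).
  simpl in *. field. repeat split; try lra; nra.
Qed.

Lemma swim_angle_entry (s : R) : 0 < s < PI / 2 -> swim_angle s (entry_time s) = PI.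
Proof.
  intros Hs. destruct (sin_cos_acute s Hs) as [H1 H2].
  unfold swim_angle, swim_coord.
  replace ((sin s * cos s - entry_time s + entry_time s) / sin s ^ 2)
    with (tan (PI / 2 - s)).
  - rewrite atan_tan by lra. lra.
  - unfold tan. rewrite sin_shift, cos_shift. field. lra.
Qed.

Lemma swim_angle_ge (s t : R) :
  0 < s < PI / 2 -> 0 <= t <= entry_time s -> PI / 2 + s <= swim_angle s t.
Proof.
  intros Hs Ht. destruct (sin_cos_acute s Hs) as [H1 H2].
  assert (0 < swim_coord s t / sin s ^ 2).
  { apply Rdiv_lt_0_compat; [apply swim_coord_pos|apply pow_lt]; try lra.
    pose proof (entry_time_bounds s Hs). lra. }
  assert (0 < atan (swim_coord s t / sin s ^ 2)).
  { rewrite <- atan_0. now apply atan_increasing. }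
  unfold swim_angle. lra.
Qed.

Lemma swim_angle_lt (s t : R) :
  0 < s < PI / 2 -> 0 <= t < entry_time s -> swim_angle s t < PI.
Proof.
  intros Hs Ht. pose proof (entry_time_bounds s Hs) as [He _].
  destruct (sin_cos_acute s Hs) as [H1 _].
  set (m := (t + entry_time s) / 2).
  assert (Hpos : forall u, - entry_time s < u < entry_time s ->
    0 < sin s ^ 2 / (swim_radius s u * swim_radius s u) - 1).
  { intros u Hu. pose proof (swim_radius_lt s u Hs Hu).
    pose proof (swim_radius_pos s u Hs).
    assert (Hrr : swim_radius s u * swim_radius s u < sin s ^ 2) by nra.
    assert (0 < swim_radius s u * swim_radius s u) by nra.
    assert (1 < sin s ^ 2 / (swim_radius s u * swim_radius s u)); [|lra].
    apply Rmult_lt_reg_r with (swim_radius s u * swim_radius s u); [assumption|].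
    replace (sin s ^ 2 / (swim_radius s u * swim_radius s u)
             * (swim_radius s u * swim_radius s u)) with (sin s ^ 2) by (field; lra).
    lra. }
  apply Rlt_le_trans with (swim_angle s m).
  - apply (incr_function (swim_angle s) (- entry_time s) (entry_time s)
      (fun u => sin s ^ 2 / (swim_radius s u * swim_radius s u) - 1)); simpl;
      unfold m; try lra.
    + intros. now apply is_derive_swim_angle.
    + intros. apply Hpos. lra.
  - rewrite <- (swim_angle_entry s Hs).
    apply (nondecreasing_derive nil); [unfold m; lra| |].
    + apply cont_on_derive. intros. eexists. now apply is_derive_swim_angle.
    + intros u Hu _. eexists. split; [now apply is_derive_swim_angle|].
      apply Rlt_le, Hpos. unfold m in Hu. lra.
Qed.

Lemma swim_angle_range (s t : R) :
  0 < s < PI / 2 -> 0 <= t <= entry_time s -> PI / 2 + s <= swim_angle s t <= PI.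
Proof.
  intros Hs Ht. split; [now apply swim_angle_ge|].
  destruct Ht as [H0 [Ht| ->]].
  - apply Rlt_le, swim_angle_lt; auto.
  - right. now apply swim_angle_entry.
Qed.

Lemma swim_heading (mu s t : R) :
  0 < mu -> 0 < s < PI / 2 -> 0 <= t < entry_time s ->
  sin (approach_heading mu (sin s) (mu * swim_radius s t)) =
    sin s ^ 2 / swim_radius s t /\
  cos (approach_heading mu (sin s) (mu * swim_radius s t)) =
    swim_coord s t / swim_radius s t.
Proof.
  intros Hmu Hs Ht. destruct (sin_cos_acute s Hs) as [H1 _].
  assert (Ht' : - entry_time s < t < entry_time s) by lra.
  pose proof (swim_radius_lt s t Hs Ht') as Hlt.
  pose proof (swim_radius_gt s t Hs (proj1 Ht')) as Hgt.
  pose proof (swim_radius_pos s t Hs) as Hp.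
  pose proof (swim_radius_sqr s t) as Hsq.
  pose proof (swim_coord_pos s t Hs (proj1 Ht')) as Hq.
  unfold approach_heading.
  destruct (Rlt_dec (mu * swim_radius s t) (mu * sin s)) as [_|Hn].
  2:{ exfalso. apply Hn. apply Rmult_lt_compat_l; assumption. }
  replace (mu * sin s ^ 2 / (mu * swim_radius s t)) with (sin s ^ 2 / swim_radius s t)
    by (field; lra).
  set (r := swim_radius s t) in *.
  assert (Hb : -1 <= sin s ^ 2 / r <= 1).
  { assert (0 <= sin s ^ 2 / r) by (apply Rdiv_le_0_compat; [apply pow2_ge_0|lra]).
    split; [lra|]. apply Rmult_le_reg_r with r; [lra|].
    replace (sin s ^ 2 / r * r) with (sin s ^ 2) by (field; lra). lra. }
  rewrite sin_asin, cos_asin by assumption. split; [reflexivity|].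
  rewrite <- (sqrt_square (swim_coord s t / r)) by (apply Rlt_le, Rdiv_lt_0_compat; lra).
  f_equal. unfold Rsqr.
  assert (Hq2 : swim_coord s t ^ 2 = r * r - sin s ^ 4) by lra.
  transitivity (swim_coord s t ^ 2 / (r * r)); [rewrite Hq2|]; field; lra.
Qed.

Lemma is_derive_sqrt_sqr_minus (y : R -> R) (t l c : R) :
  0 < y t ^ 2 - c -> is_derive y t l ->
  is_derive (fun u => sqrt (y u ^ 2 - c)) t (y t * l / sqrt (y t ^ 2 - c)).
Proof.
  intros Hy H. evar_last.
  - auto_derive; [split; [eexists; exact H|split; [exact Hy|trivial]]|reflexivity].
  - change (Derive (fun u => y u) t) with (Derive y t).
    rewrite (is_derive_unique _ _ _ H).
    assert (0 < sqrt (y t ^ 2 - c)) by (now apply sqrt_lt_R0).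
    unfold Rminus in *. simpl in *. field. lra.
Qed.

Lemma opposition_approach (mu s T t2 : R) (x : R -> state) (psi omega : R -> R) :
  0 < mu -> 0 < s < PI / 2 ->
  motion mu T x psi omega -> follows_L (opposition mu (sin s)) T x psi omega ->
  x 0 = (mu * swim_radius s 0, swim_angle s 0) ->
  0 <= t2 <= entry_time s -> t2 <= T ->
  (forall t, 0 <= t < t2 ->
     0 < fst (x t) < mu * sin s /\ cos (snd (x t)) <> -1) ->
  fst (x t2) = mu * swim_radius s t2 /\ swim_angle s t2 <= snd (x t2) <= PI /\
  (forall t, 0 <= t <= t2 -> 0 < fst (x t) <= mu).
Proof.
  intros Hmu Hs Hm Hf Hx0 Ht2 HT Hbefore.
  pose proof PI_RGT_0 as HPI.
  destruct (sin_cos_acute s Hs) as [Hk Hc].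
  pose proof (entry_time_bounds s Hs) as [He _].
  pose proof (motion_fst_cont _ _ _ _ _ Hm) as Hcr.
  pose proof Hm as [_ [Hm1 [L HL]]].
  assert (H0 : fst (x 0) = mu * swim_radius s 0) by (rewrite Hx0; reflexivity).
  assert (Hth0 : snd (x 0) = swim_angle s 0) by (rewrite Hx0; reflexivity).
  set (h := mu * sin s ^ 2).
  assert (Hh : 0 < h) by (apply Rmult_lt_0_compat; [lra|apply pow_lt; lra]).
  assert (Hmk : mu * sin s < mu) by nra.
  assert (Hgt0 : h < fst (x 0)).
  { rewrite H0. apply Rmult_lt_compat_l; [lra|]. apply swim_radius_gt; [assumption|lra]. }
  assert (Hge : forall t, 0 <= t <= t2 -> fst (x 0) <= fst (x t)).
  { intros t Ht.
    apply (opposition_radius_nondecreasing mu (sin s) T 0 t x psi omega); auto; [lra|lra|].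
    intros u Hu. destruct (Hbefore u) as [[_ H] _]; lra. }
  set (Q := fun t => sqrt (fst (x t) ^ 2 - h ^ 2)).
  assert (Hin : forall t, 0 <= t <= t2 -> 0 < fst (x t) ^ 2 - h ^ 2).
  { intros t Ht. specialize (Hge t Ht). nra. }
  assert (HQpos : forall t, 0 <= t <= t2 -> 0 < Q t) by (intros; now apply sqrt_lt_R0, Hin).
  assert (HQ2 : forall t, 0 <= t <= t2 -> Q t * Q t = fst (x t) ^ 2 - h ^ 2).
  { intros t Ht. apply sqrt_sqrt. now apply Rlt_le, Hin. }
  assert (Hhead : forall t, 0 <= t < t2 ->
    sin (approach_heading mu (sin s) (fst (x t))) = h / fst (x t) /\
    cos (approach_heading mu (sin s) (fst (x t))) = Q t / fst (x t)).
  { intros t Ht. destruct (Hbefore t Ht) as [[Hr Hrk] _].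
    assert (Ht' : 0 <= t <= t2) by lra.
    specialize (Hge t Ht'). specialize (HQ2 t Ht'). specialize (HQpos t Ht').
    unfold approach_heading. destruct (Rlt_dec (fst (x t)) (mu * sin s)) as [_|]; [|lra].
    fold h. set (r := fst (x t)) in *.
    assert (Hb : -1 <= h / r <= 1).
    { assert (0 <= h / r) by (apply Rdiv_le_0_compat; lra).
      split; [lra|]. apply Rmult_le_reg_r with r; [lra|].
      replace (h / r * r) with h by (field; lra). lra. }
    rewrite sin_asin, cos_asin by assumption. split; [reflexivity|].
    rewrite <- (sqrt_square (Q t / r)) by (apply Rlt_le, Rdiv_lt_0_compat; lra).
    f_equal. unfold Rsqr. transitivity ((Q t * Q t) / (r * r)); [rewrite HQ2|]; field; lra. }
  assert (HQd : forall t, 0 < t < t2 -> ~ In t L -> is_derive Q t mu).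
  { intros t Ht HtL. destruct (HL t) as [_ [Hd _]]; [lra|assumption|].
    assert (Ht' : 0 <= t <= t2) by lra. assert (Ht'' : 0 <= t < t2) by lra.
    destruct (Hhead t Ht'') as [_ Hcos]. destruct (Hbefore t Ht'') as [[Hr Hrk] Hna].
    rewrite (Hf t), (surjective_pairing (x t)), opposition_off in Hd by (assumption || lra).
    unfold r_rate in Hd.
    rewrite cos_sgn_mult in Hd
      by (destruct (sgn_sin_cases (snd (x t))) as [[-> _]|[-> _]]; auto).
    rewrite Hcos in Hd.
    pose proof (is_derive_sqrt_sqr_minus (fun u => fst (x u)) t _ (h ^ 2) (Hin t Ht') Hd)
      as HdQ.
    cbv beta in HdQ. specialize (HQpos t Ht'). unfold Q in *.
    replace mu with (fst (x t) * (mu * (sqrt (fst (x t) ^ 2 - h ^ 2) / fst (x t)))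
                     / sqrt (fst (x t) ^ 2 - h ^ 2)) by (field; lra).
    exact HdQ. }
  assert (HQc : cont_on 0 t2 Q).
  { apply (cont_on_comp 0 t2 (fun t => fst (x t) ^ 2 - h ^ 2) sqrt).
    - apply cont_on_minus; [|apply cont_on_const].
      apply (cont_on_ext 0 t2 (fun t => fst (x t) * fst (x t))); [intros; ring|].
      apply cont_on_mult; apply (cont_on_subset 0 T); auto; lra.
    - intros; apply continuous_sqrt. }
  assert (HQ : forall t, 0 <= t <= t2 -> Q t = mu * swim_coord s t).
  { intros t Ht.
    assert (HQ0 : Q 0 = mu * swim_coord s 0).
    { unfold Q. rewrite H0.
      replace ((mu * swim_radius s 0) ^ 2 - h ^ 2)
        with ((mu * swim_coord s 0) * (mu * swim_coord s 0)).
      - apply sqrt_square. apply Rmult_le_pos; [lra|].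
        apply Rlt_le, swim_coord_pos; [assumption|lra].
      - pose proof (swim_radius_sqr s 0) as Hsq. unfold h.
        replace ((mu * swim_radius s 0) ^ 2)
          with (mu * mu * (swim_radius s 0 * swim_radius s 0)) by ring.
        rewrite Hsq. ring. }
    assert (Hct : cont_on 0 t (fun u => Q u - mu * u)).
    { apply cont_on_minus; [apply (cont_on_subset 0 t2); auto; lra|].
      apply cont_on_derive; intros; auto_derive; trivial. }
    assert (Hdt : forall u, 0 < u < t -> ~ In u L -> is_derive (fun u => Q u - mu * u) u 0).
    { intros u Hu HuL. replace 0 with (mu - mu) by ring.
      apply (is_derive_minus (V := R_NormedModule)).
      - apply HQd; [lra|assumption].
      - auto_derive; [trivial|ring]. }
    assert (Hup : Q t - mu * t <= Q 0 - mu * 0).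
    { apply (nonincreasing_derive L (fun u => Q u - mu * u)); [lra|assumption|].
      intros u Hu HuL. exists 0. split; [now apply Hdt|lra]. }
    assert (Hdown : Q 0 - mu * 0 <= Q t - mu * t).
    { apply (nondecreasing_derive L (fun u => Q u - mu * u)); [lra|assumption|].
      intros u Hu HuL. exists 0. split; [now apply Hdt|lra]. }
    unfold swim_coord in *. lra. }
  assert (Hr : forall t, 0 <= t <= t2 -> fst (x t) = mu * swim_radius s t).
  { intros t Ht. specialize (Hge t Ht). specialize (HQ2 t Ht). rewrite (HQ t Ht) in HQ2.
    pose proof (swim_radius_sqr s t) as Hsq. pose proof (swim_radius_pos s t Hs).
    apply Rsqr_inj; [lra|apply Rmult_le_pos; lra|]. unfold Rsqr.
    replace (mu * swim_radius s t * (mu * swim_radius s t))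
      with (mu * mu * (swim_radius s t * swim_radius s t)) by ring.
    rewrite Hsq. unfold h in HQ2.
    replace (fst (x t) * fst (x t)) with (fst (x t) ^ 2) by ring.
    replace (fst (x t) ^ 2) with (mu * swim_coord s t * (mu * swim_coord s t)
       + (mu * sin s ^ 2) ^ 2) by lra. ring. }
  assert (Hall : forall t, 0 <= t <= t2 -> 0 < fst (x t) <= mu).
  { intros t Ht. rewrite (Hr t Ht). pose proof (swim_radius_pos s t Hs).
    assert (Ht' : 0 <= t <= entry_time s) by lra.
    pose proof (swim_radius_le s t Hs Ht'). split; nra. }
  split; [apply Hr; lra|]. split; [|exact Hall].
  assert (Hcth : cont_on 0 t2 (fun t => snd (x t))).
  { apply (motion_snd_cont _ _ _ _ _ _ _ Hm); [lra|lra|]. intros t Ht. apply (Hall t Ht). }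
  pose proof (swim_angle_ge s 0 Hs) as Ha0.
  pose proof (swim_angle_lt s 0 Hs) as Ha1.
  assert (Hcos : forall t, 0 <= t <= t2 -> cos (snd (x t)) <= 0).
  { intros t Ht. apply Rle_trans with (cos (snd (x 0))).
    - apply (opposition_cos_nonincreasing mu (sin s) T 0 t x psi omega); auto;
        [lra|lra|lra|]. intros u Hu. apply Hall. lra.
    - rewrite Hth0. apply cos_le_0; lra. }
  assert (Hlow : forall t, 0 <= t <= t2 -> PI / 2 <= snd (x t)).
  { intros t Ht. apply Rnot_lt_le. intros Hlt.
    set (m := Rmax 0 (snd (x t))).
    assert (Hm' : 0 <= m < PI / 2 /\ snd (x t) <= m).
    { unfold m. pose proof (Rmax_l 0 (snd (x t))). pose proof (Rmax_r 0 (snd (x t))).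
      split; [split; [assumption|apply Rmax_lub_lt; lra]|assumption]. }
    destruct (first_hit_zero (fun u => snd (x u) - m) 0 t) as [u [Hu [Hum _]]].
    - lra.
    - apply cont_on_minus; [|apply cont_on_const]. apply (cont_on_subset 0 t2); auto; lra.
    - rewrite Hth0. lra.
    - lra.
    - assert (Hu' : 0 <= u <= t2) by lra. specialize (Hcos u Hu').
      assert (0 < cos (snd (x u))) by (apply cos_gt_0; lra). lra. }
  assert (Hupp : forall t, 0 <= t <= t2 -> snd (x t) <= PI).
  { intros t Ht. apply Rnot_lt_le. intros Hlt.
    destruct (first_hit_zero (fun u => PI - snd (x u)) 0 t) as [u [Hu [Hum _]]].
    - lra.
    - apply cont_on_minus; [apply cont_on_const|]. apply (cont_on_subset 0 t2); auto; lra.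
    - rewrite Hth0. lra.
    - lra.
    - assert (u <> t) by (intros ->; lra).
      destruct (Hbefore u) as [_ Hna]; [lra|]. apply Hna.
      replace (snd (x u)) with PI by lra. apply cos_PI. }
  split; [|apply Hupp; lra].
  assert (Hmon : snd (x 0) - swim_angle s 0 <= snd (x t2) - swim_angle s t2); [|lra].
  apply (nondecreasing_derive L (fun t => snd (x t) - swim_angle s t)); [lra| |].
  - apply cont_on_minus; [assumption|]. apply cont_on_derive.
    intros. eexists. now apply is_derive_swim_angle.
  - intros t Ht HtL. destruct (HL t) as [_ [_ Hd]]; [lra|assumption|].
    assert (Ht' : 0 <= t <= t2) by lra. assert (Ht'' : 0 <= t < t2) by lra.
    destruct (Hhead t Ht'') as [Hsin _]. destruct (Hbefore t Ht'') as [[Hrp Hrk] Hna].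
    destruct (Hm1 t) as [_ [_ [Hw _]]]; [lra|].
    eexists. split.
    { apply (is_derive_minus (V := R_NormedModule)); [exact Hd|].
      now apply is_derive_swim_angle. }
    rewrite (Hf t) by lra.
    rewrite (surjective_pairing (x t)) at 2.
    rewrite opposition_off by (assumption || lra).
    assert (Hsg : sgn_sin (snd (x t)) = 1).
    { destruct (sgn_sin_cases (snd (x t))) as [[-> _]|[_ Hneg]]; [reflexivity|].
      assert (0 <= sin (snd (x t))); [|lra].
      specialize (Hlow t Ht'). specialize (Hupp t Ht'). apply sin_ge_0; lra. }
    rewrite Hsg, Rmult_1_l. unfold theta_rate. rewrite Hsin, (Hr t Ht').
    pose proof (swim_radius_pos s t Hs).
    change (minus ?a ?b) with (a - b). unfold h.
    replace (mu / (mu * swim_radius s t) * (mu * sin s ^ 2 / (mu * swim_radius s t)))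
      with (sin s ^ 2 / (swim_radius s t * swim_radius s t)) by (field; lra).
    lra.
Qed.

Lemma opposition_reaches_antipodal (mu s T : R) (x : R -> state)
    (psi omega : R -> R) :
  0 < mu -> 0 < s < PI / 2 ->
  motion mu T x psi omega -> follows_L (opposition mu (sin s)) T x psi omega ->
  x 0 = (mu * swim_radius s 0, swim_angle s 0) -> entry_time s <= T ->
  exists t, 0 <= t <= entry_time s /\ fst (x t) = mu * swim_radius s t /\
    cos (snd (x t)) = -1 /\ forall u, 0 <= u <= t -> 0 < fst (x u) <= mu.
Proof.
  intros Hmu Hs Hm Hf Hx0 HT. pose proof PI_RGT_0 as HPI.
  pose proof (entry_time_bounds s Hs) as [He _].
  destruct (sin_cos_acute s Hs) as [Hk _].
  pose proof (motion_fst_cont _ _ _ _ _ Hm) as Hcr.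
  pose proof Hm as [_ [Hm1 _]].
  set (f := fun t => (fst (x t) + fst (x t) * cos (snd (x t))) * (mu * sin s - fst (x t))).
  assert (Hfc : forall b, b <= T -> cont_on 0 b f).
  { intros b Hb. apply (cont_on_subset 0 T); [lra|lra|].
    apply cont_on_mult.
    - apply cont_on_plus; [assumption|].
      apply (motion_polar_cont _ _ _ _ _ cos Hm).
      + intros; apply continuous_cos.
      + intros v. apply Rabs_le. pose proof (COS_bound v); lra.
    - apply cont_on_minus; [apply cont_on_const|assumption]. }
  assert (Hfpos : forall t, 0 <= t <= T -> 0 < f t ->
            0 < fst (x t) < mu * sin s /\ cos (snd (x t)) <> -1).
  { intros t Ht Hft. destruct (Hm1 t Ht) as [Hr _].
    pose proof (COS_bound (snd (x t))). unfold f in Hft.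
    assert (Hg : 0 <= fst (x t) + fst (x t) * cos (snd (x t))) by nra.
    assert (Hlt : fst (x t) < mu * sin s) by (apply Rnot_le_lt; intros Hn; nra).
    split; [split; [|assumption]|].
    - destruct Hr as [Hr|E]; [assumption|]. rewrite <- E in Hft. lra.
    - intros E. rewrite E in Hft. lra. }
  assert (Hend : exists c, 0 <= c <= entry_time s /\ f c <= 0).
  { apply NNPP. intros Hn.
    assert (Hpos : forall t, 0 <= t <= entry_time s -> 0 < f t).
    { intros t Ht. apply Rnot_le_lt. intros Hle. apply Hn. exists t. tauto. }
    destruct (opposition_approach mu s T (entry_time s) x psi omega) as [Hr _]; auto.
    - lra.
    - intros t Ht. apply Hfpos; [lra|]. apply Hpos. lra.
    - destruct (Hfpos (entry_time s)) as [Hlt _]; [lra|apply Hpos; lra|].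
      rewrite Hr, swim_radius_entry in Hlt by assumption. lra. }
  destruct Hend as [c [Hc Hfc0]].
  destruct (first_hit f 0 c) as [t [Ht [Hft Hfb]]]; [lra|apply Hfc; lra|assumption|].
  destruct (opposition_approach mu s T t x psi omega) as [Hr [Hth Hall]]; auto.
  - lra.
  - lra.
  - intros u Hu. apply Hfpos; [lra|]. apply Hfb. lra.
  - exists t. split; [lra|]. split; [assumption|]. split; [|assumption].
    destruct (Rle_lt_or_eq_dec t (entry_time s)) as [Hlt|E]; [lra| |].
    + assert (Ht' : - entry_time s < t < entry_time s) by lra.
      pose proof (swim_radius_lt s t Hs Ht') as Hrl.
      pose proof (swim_radius_pos s t Hs). pose proof (COS_bound (snd (x t))).
      apply Rle_antisym; [|lra]. apply Rnot_lt_le. intros Hgt.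
      assert (0 < f t); [|lra]. unfold f. rewrite Hr.
      apply Rmult_lt_0_compat; [|nra].
      assert (0 < mu * swim_radius s t) by (apply Rmult_lt_0_compat; lra). nra.
    + subst t. rewrite swim_angle_entry in Hth by assumption.
      replace (snd (x (entry_time s))) with PI by lra. apply cos_PI.
Qed.

(** Arriving on the focal line early is no loss, since along the tributary the
    time to [E] through the focal line decreases at rate at most 1. *)
Lemma swim_arrival (s t : R) :
  0 < s < PI / 2 -> 0 <= t <= entry_time s ->
  t + acos (swim_radius s t) <= entry_time s + (PI / 2 - s).
Proof.
  intros Hs Ht. pose proof PI_RGT_0 as HPI.
  destruct (sin_cos_acute s Hs) as [Hk _].
  pose proof (entry_time_bounds s Hs) as [He _].
  assert (Hmon : asin (swim_radius s (entry_time s)) - entry_time s <=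
                 asin (swim_radius s t) - t).
  { assert (Hr : forall u, t <= u <= entry_time s -> 0 < swim_radius s u <= sin s).
    { intros u Hu. split; [now apply swim_radius_pos|]. apply swim_radius_le; [assumption|lra]. }
    assert (Hd : forall u, t <= u <= entry_time s ->
      is_derive (fun v => asin (swim_radius s v) - v) u
        (/ sqrt (1 - swim_radius s u ^ 2) * (swim_coord s u / swim_radius s u) - 1)).
    { intros u Hu. specialize (Hr u Hu).
      apply is_derive_asin_minus_id; [lra|]. now apply is_derive_swim_radius. }
    apply (nonincreasing_derive nil (fun v => asin (swim_radius s v) - v)); [lra| |].
    - apply cont_on_derive. intros u Hu. eexists. now apply Hd.
    - intros u Hu _. assert (Hu' : t <= u <= entry_time s) by lra.
      eexists. split; [now apply Hd|].
      specialize (Hr u Hu'). set (r := swim_radius s u) in *.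
      pose proof (swim_radius_sqr s u) as Hsq. fold r in Hsq.
      assert (Hq : 0 < swim_coord s u) by (apply swim_coord_pos; [assumption|lra]).
      set (q := swim_coord s u) in *.
      assert (Hw : 0 < sqrt (1 - r ^ 2)) by (apply sqrt_lt_R0; nra).
      assert (Hle : q <= r * sqrt (1 - r ^ 2)).
      { apply Rsqr_incr_0; [|lra|nra]. unfold Rsqr.
        replace (r * sqrt (1 - r ^ 2) * (r * sqrt (1 - r ^ 2)))
          with (r * r * (sqrt (1 - r ^ 2) * sqrt (1 - r ^ 2))) by ring.
        rewrite sqrt_sqrt by nra.
        assert (r * r <= sin s ^ 2) by nra.
        assert (0 <= r * r) by nra.
        assert (r * r * (r * r) <= sin s ^ 4)
          by (replace (sin s ^ 4) with (sin s ^ 2 * sin s ^ 2) by ring; nra).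
        nra. }
      replace (/ sqrt (1 - r ^ 2) * (q / r) - 1)
        with (- ((r * sqrt (1 - r ^ 2) - q) * / (sqrt (1 - r ^ 2) * r))) by (field; lra).
      assert (0 <= (r * sqrt (1 - r ^ 2) - q) * / (sqrt (1 - r ^ 2) * r)); [|lra].
      apply Rmult_le_pos; [lra|]. apply Rlt_le, Rinv_0_lt_compat.
      apply Rmult_lt_0_compat; lra. }
  rewrite swim_radius_entry, asin_sin in Hmon by (assumption || lra).
  pose proof (swim_radius_pos s t Hs). pose proof (swim_radius_le s t Hs Ht).
  rewrite acos_asin by lra. lra.
Qed.

(** * Saddle points *)

Lemma in_game_inside (mu : R) (x : state) :
  mu < 1 -> 0 <= fst x <= mu -> in_game mu x.
Proof. intros H1 Hx. split; [lra|]. intros; lra. Qed.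

Lemma focal_dynamics (mu k t : R) :
  0 < mu -> 0 < t <= PI / 2 ->
  opposition mu k (mu * sin t, PI) 1 = t /\ 0 < mu * sin t <= mu.
Proof.
  intros Hmu Ht. pose proof PI_RGT_0.
  assert (0 < sin t) by (apply sin_gt_0; lra). pose proof (SIN_bound t).
  assert (Hr : 0 < mu * sin t <= mu) by (split; nra).
  split; [|assumption].
  rewrite opposition_antipodal; [|lra|apply cos_PI].
  replace (mu * sin t * 1 / mu) with (sin t) by (field; lra). apply asin_sin; lra.
Qed.

Lemma focal_play (mu eta k s : R) :
  0 < mu < 1 -> 0 < eta <= PI / 2 -> 0 < s <= PI / 2 ->
  equilibrium_play mu (opposition mu k) (pursuit eta) (PI / 2 - s)
    (fun t => (mu * sin (s + t), PI)).
Proof.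
  intros Hmu Heta Hs. pose proof PI_RGT_0 as HPI.
  split; [|split].
  - exists (fun t => opposition mu k (mu * sin (s + t), PI) 1), (fun _ => 1).
    split; [split; [lra|split]|split].
    + intros t Ht. destruct (focal_dynamics mu k (s + t)) as [E Hr]; [lra|lra|].
      rewrite E. split; [simpl; lra|]. split; [lra|]. split; [lra|]. split; [|intros _].
      * apply (cont_on_derive 0 (PI / 2 - s) (fun u => mu * sin (s + u))); [|exact Ht].
        intros. auto_derive. trivial.
      * apply (cont_on_const 0 (PI / 2 - s) PI t Ht).
    + exists nil. intros t Ht _.
      destruct (focal_dynamics mu k (s + t)) as [E Hr]; [lra|lra|].
      rewrite E. split; [simpl; lra|]. split.
      * simpl. unfold r_rate. auto_derive; [trivial|ring].
      * change (is_derive (fun _ : R => PI) t (theta_rate mu (mu * sin (s + t)) (s + t) 1)).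
        unfold theta_rate.
        replace (mu / (mu * sin (s + t)) * sin (s + t) - 1) with 0.
        -- auto_derive; trivial.
        -- assert (sin (s + t) <> 0) by (intros E0; rewrite E0 in Hr; lra).
           field. lra.
    + intros t _. reflexivity.
    + intros t _. symmetry. apply pursuit_at_PI; [assumption|apply cos_PI].
  - intros t Ht. apply in_game_inside; [lra|].
    destruct (focal_dynamics mu k (s + t)) as [_ Hr]; [lra|lra|]. simpl. lra.
  - split; simpl.
    + replace (s + (PI / 2 - s)) with (PI / 2) by ring. rewrite sin_PI2. ring.
    + apply cos_PI.
Qed.

Lemma focal_saddle_point (mu eta s : R) :
  0 < mu < 1 -> 0 < eta <= PI / 2 -> 0 < s <= PI / 2 ->
  saddle_point mu (mu * sin s, PI) (opposition mu 0) (pursuit eta) (PI / 2 - s).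
Proof.
  intros Hmu Heta Hs. pose proof PI_RGT_0 as HPI.
  destruct (focal_dynamics mu 0 s) as [_ Hr]; [lra|lra|].
  split; [apply opposition_admissible; lra|].
  split; [apply pursuit_admissible; lra|].
  split; [|split].
  - exists (fun t => (mu * sin (s + t), PI)).
    split; [now rewrite Rplus_0_r|]. now apply focal_play.
  - intros x psi omega Hx Hm Hf.
    assert (HV : acos (fst (x 0) / mu) = PI / 2 - s).
    { rewrite Hx; simpl. replace (mu * sin s / mu) with (sin s) by (field; lra).
      rewrite <- cos_shift. apply acos_cos. lra. }
    destruct (opposition_reaches_E_from_antipodal mu 0 (PI / 2 - s) 0 x psi omega)
      as [t [Ht [HE Hin]]]; auto; try lra.
    + rewrite Hx; simpl. lra.
    + rewrite Hx; simpl. apply cos_PI.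
    + exists t. split; [lra|]. split; [assumption|].
      intros u Hu. apply in_game_inside; [lra|]. now apply Hin.
  - intros t x psi omega Hx Hm Hf _ HE. apply Rnot_lt_le. intros Hlt.
    pose proof Hm as [Ht _].
    apply (not_at_E_after mu eta t 0 t s x psi omega); auto; try lra.
    rewrite Hx; simpl. rewrite cos_PI, sin_PI, Rabs_R0. lra.
Qed.

Definition tributary_path (mu s t : R) : state :=
  if Rlt_dec t (entry_time s) then (mu * swim_radius s t, swim_angle s t)
  else (mu * sin (s + (t - entry_time s)), PI).

Lemma tributary_path_before (mu s t : R) :
  0 < s < PI / 2 -> t <= entry_time s ->
  tributary_path mu s t = (mu * swim_radius s t, swim_angle s t).
Proof.
  intros Hs Ht. unfold tributary_path. destruct (Rlt_dec t (entry_time s)); [reflexivity|].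
  replace t with (entry_time s) by lra.
  rewrite swim_radius_entry, swim_angle_entry by assumption.
  repeat f_equal. ring.
Qed.

Lemma tributary_path_after (mu s t : R) :
  entry_time s <= t -> tributary_path mu s t = (mu * sin (s + (t - entry_time s)), PI).
Proof.
  intros Ht. unfold tributary_path. destruct (Rlt_dec t (entry_time s)); [lra|reflexivity].
Qed.

Lemma cont_on_glue (a b c : R) (f g h : R -> R) :
  a <= b <= c -> cont_on a b f -> cont_on b c g ->
  (forall t, a <= t <= b -> h t = f t) -> (forall t, b <= t <= c -> h t = g t) ->
  cont_on a c h.
Proof.
  intros Hab Hf Hg Hhf Hhg. apply cont_on_intro. intros t e Ht He.
  destruct (Rtotal_order t b) as [Hlt|[E|Hgt]].
  - destruct (cont_on_eps a b f t e Hf) as [d [Hd Hc]]; [lra|assumption|].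
    exists (Rmin d (b - t)). split; [apply Rmin_glb_lt; lra|].
    intros u Hu Hut. pose proof (Rmin_l d (b - t)). pose proof (Rmin_r d (b - t)).
    assert (u < b) by (apply Rabs_def2 in Hut; lra).
    rewrite !Hhf by lra. apply Hc; lra.
  - subst t. destruct (cont_on_eps a b f b e Hf) as [d1 [Hd1 Hc1]]; [lra|assumption|].
    destruct (cont_on_eps b c g b e Hg) as [d2 [Hd2 Hc2]]; [lra|assumption|].
    exists (Rmin d1 d2). split; [apply Rmin_glb_lt; assumption|].
    intros u Hu Hut. pose proof (Rmin_l d1 d2). pose proof (Rmin_r d1 d2).
    destruct (Rle_dec u b).
    + rewrite !Hhf by lra. apply Hc1; lra.
    + rewrite !Hhg by lra. apply Hc2; lra.
  - destruct (cont_on_eps b c g t e Hg) as [d [Hd Hc]]; [lra|assumption|].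
    exists (Rmin d (t - b)). split; [apply Rmin_glb_lt; lra|].
    intros u Hu Hut. pose proof (Rmin_l d (t - b)). pose proof (Rmin_r d (t - b)).
    assert (b < u) by (apply Rabs_def2 in Hut; lra).
    rewrite !Hhg by lra. apply Hc; lra.
Qed.

Lemma is_derive_ext_below (f g : R -> R) (t b l : R) :
  t < b -> (forall u, u < b -> f u = g u) -> is_derive f t l -> is_derive g t l.
Proof.
  intros Ht H. apply is_derive_ext_loc.
  assert (Hd : 0 < b - t) by lra.
  exists (mkposreal _ Hd). intros u Hu. change (Rabs (u - t) < b - t) in Hu.
  apply Rabs_def2 in Hu. apply H. lra.
Qed.

Lemma is_derive_ext_above (f g : R -> R) (t b l : R) :
  b < t -> (forall u, b < u -> f u = g u) -> is_derive f t l -> is_derive g t l.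
Proof.
  intros Ht H. apply is_derive_ext_loc.
  assert (Hd : 0 < t - b) by lra.
  exists (mkposreal _ Hd). intros u Hu. change (Rabs (u - t) < t - b) in Hu.
  apply Rabs_def2 in Hu. apply H. lra.
Qed.

Lemma left_quotient (f g : R -> R) (t l : R) :
  is_derive f t l -> (forall u, u <= t -> g u = f u) ->
  filterlim (fun u => (g u - g t) / (u - t)) (at_left t) (locally l).
Proof.
  intros Hd Hg. apply is_derive_Reals in Hd.
  apply filterlim_locally. intros [e He].
  destruct (Hd e He) as [d Hc]. exists d. intros u Hu Hlt.
  change (Rabs (u - t) < d) in Hu.
  specialize (Hc (u - t)). rewrite (Rplus_minus t u) in Hc.
  rewrite !Hg by lra. apply Hc; [lra|assumption].
Qed.

Lemma tributary_fst_bounds (mu s t : R) :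
  0 < mu -> 0 < s < PI / 2 -> 0 <= t <= entry_time s + (PI / 2 - s) ->
  0 < fst (tributary_path mu s t) <= mu.
Proof.
  intros Hmu Hs Ht. destruct (sin_cos_acute s Hs) as [Hk _].
  destruct (Rle_dec t (entry_time s)).
  - rewrite tributary_path_before by assumption. simpl.
    assert (Ht' : 0 <= t <= entry_time s) by lra.
    pose proof (swim_radius_pos s t Hs). pose proof (swim_radius_le s t Hs Ht').
    split; nra.
  - rewrite tributary_path_after by lra. simpl.
    apply (focal_dynamics mu 0); lra.
Qed.

Lemma tributary_play (mu s : R) :
  0 < mu < 1 -> 0 < s < PI / 2 ->
  equilibrium_play mu (opposition mu (sin s)) (pursuit s)
    (entry_time s + (PI / 2 - s)) (tributary_path mu s).
Proof.
  intros Hmu Hs. pose proof PI_RGT_0 as HPI.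
  destruct (sin_cos_acute s Hs) as [Hk _].
  pose proof (entry_time_bounds s Hs) as [He _].
  set (T := entry_time s + (PI / 2 - s)).
  assert (Hb : forall t, 0 <= t <= T -> 0 < fst (tributary_path mu s t) <= mu)
    by (unfold T; intros; apply tributary_fst_bounds; lra).
  split; [|split].
  - exists (fun t => opposition mu (sin s) (tributary_path mu s t) 1), (fun _ => 1).
    split; [split; [unfold T; lra|split]|split].
    + intros t Ht. specialize (Hb t Ht).
      pose proof (opposition_bound mu (sin s) (tributary_path mu s t) 1 (proj2 Hb)).
      split; [lra|]. split; [lra|]. split; [lra|]. split; [|intros _].
      * apply (cont_on_glue 0 (entry_time s) T (fun u => mu * swim_radius s u)
          (fun u => mu * sin (s + (u - entry_time s)))); [unfold T; lra| | | | |exact Ht].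
        -- apply cont_on_mult; [apply cont_on_const|]. apply cont_on_derive.
           intros. eexists. now apply is_derive_swim_radius.
        -- apply cont_on_derive. intros. auto_derive. trivial.
        -- intros u Hu. now rewrite tributary_path_before by lra.
        -- intros u Hu. now rewrite tributary_path_after by lra.
      * apply (cont_on_glue 0 (entry_time s) T (swim_angle s) (fun _ => PI));
          [unfold T; lra| | | | |exact Ht].
        -- apply cont_on_derive. intros. eexists. now apply is_derive_swim_angle.
        -- apply cont_on_const.
        -- intros u Hu. now rewrite tributary_path_before by lra.
        -- intros u Hu. now rewrite tributary_path_after by lra.
    + exists (entry_time s :: nil). intros t Ht Hn.
      assert (Hte : t <> entry_time s) by (intros E; apply Hn; left; lra).
      split; [apply Hb; lra|].
      destruct (Rlt_dec t (entry_time s)) as [Hlt|Hgt].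
      * assert (Ht' : 0 <= t < entry_time s) by lra.
        destruct (swim_heading mu s t (proj1 Hmu) Hs Ht') as [Hsin Hcos].
        pose proof (swim_angle_lt s t Hs Ht') as Ha1.
        assert (Ha0 : PI / 2 + s <= swim_angle s t) by (apply swim_angle_ge; lra).
        assert (Hs0 : 0 < sin (swim_angle s t)) by (apply sin_gt_0; lra).
        pose proof (swim_radius_pos s t Hs).
        assert (Hpsi : opposition mu (sin s) (tributary_path mu s t) 1 =
                  approach_heading mu (sin s) (mu * swim_radius s t)).
        { assert (Ht'' : 0 <= t <= T) by (unfold T; lra). specialize (Hb t Ht'').
          rewrite tributary_path_before in * by lra. simpl in Hb.
          rewrite opposition_off.
          - destruct (sgn_sin_cases (swim_angle s t)) as [[-> _]|[_ Hneg]]; lra.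
          - lra.
          - intros E. pose proof (sin2_cos2 (swim_angle s t)) as Hsc.
            rewrite E in Hsc. unfold Rsqr in Hsc. nra. }
        rewrite Hpsi. unfold r_rate, theta_rate.
        rewrite Hsin, Hcos. split.
        -- apply (is_derive_ext_below (fun u => mu * swim_radius s u)) with (b := entry_time s);
             [assumption| |].
           ++ intros u Hu. now rewrite tributary_path_before by lra.
           ++ apply (is_derive_scal (swim_radius s)). now apply is_derive_swim_radius.
        -- apply (is_derive_ext_below (swim_angle s)) with (b := entry_time s);
             [assumption| |].
           ++ intros u Hu. now rewrite tributary_path_before by lra.
           ++ rewrite tributary_path_before by lra. simpl fst.
              replace (mu / (mu * swim_radius s t) * (sin s ^ 2 / swim_radius s t))
                with (sin s ^ 2 / (swim_radius s t * swim_radius s t)) by (field; lra).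
              now apply is_derive_swim_angle.
      * assert (Ha : 0 < s + (t - entry_time s) <= PI / 2) by (unfold T in Ht; lra).
        destruct (focal_dynamics mu (sin s) (s + (t - entry_time s))) as [Hpsi Hr];
          [lra|assumption|].
        rewrite (tributary_path_after mu s t) by lra. rewrite Hpsi.
        unfold r_rate, theta_rate. split.
        -- apply (is_derive_ext_above (fun u => mu * sin (s + (u - entry_time s))))
             with (b := entry_time s); [lra| |].
           ++ intros u Hu. now rewrite tributary_path_after by lra.
           ++ auto_derive; [trivial|]. unfold Rminus. ring.
        -- apply (is_derive_ext_above (fun _ => PI)) with (b := entry_time s); [lra| |].
           ++ intros u Hu. now rewrite tributary_path_after by lra.
           ++ simpl fst. replace (mu / (mu * sin (s + (t - entry_time s))) *
                sin (s + (t - entry_time s)) - 1) with 0.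
              ** auto_derive; trivial.
              ** assert (sin (s + (t - entry_time s)) <> 0)
                   by (intros E0; rewrite E0 in Hr; lra).
                 field. lra.
    + intros t _. reflexivity.
    + intros t Ht. symmetry. destruct (Rlt_dec t (entry_time s)) as [Hlt|Hgt].
      * rewrite tributary_path_before by lra.
        apply pursuit_saturated with (v := swim_angle s t); auto; try lra.
        split; [|apply swim_angle_lt; lra].
        assert (PI / 2 + s <= swim_angle s t) by (apply swim_angle_ge; lra). lra.
      * rewrite tributary_path_after by lra. apply pursuit_at_PI; [lra|apply cos_PI].
  - intros t Ht. apply in_game_inside; [lra|]. specialize (Hb t Ht). lra.
  - unfold T. rewrite tributary_path_after by lra. split; simpl.
    + replace (s + (entry_time s + (PI / 2 - s) - entry_time s)) with (PI / 2) by ring.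
      rewrite sin_PI2. ring.
    + apply cos_PI.
Qed.

Lemma swim_front_start (mu s : R) :
  0 < s < PI / 2 ->
  mu * swim_radius s 0 *
    (cos (swim_angle s 0) * cos (s + entry_time s)
     + Rabs (sin (swim_angle s 0)) * sin (s + entry_time s)) =
  mu * entry_time s - mu * sin s * cos s.
Proof.
  intros Hs. pose proof PI_RGT_0. destruct (sin_cos_acute s Hs) as [Hk _].
  pose proof (entry_time_bounds s Hs) as [He _].
  assert (Ha : PI / 2 + s <= swim_angle s 0 <= PI) by (apply swim_angle_range; lra).
  rewrite Rabs_right by (apply Rle_ge, sin_ge_0; lra).
  rewrite <- cos_minus.
  replace (swim_angle s 0 - (s + entry_time s))
    with (PI / 2 + atan (swim_coord s 0 / sin s ^ 2)) by (unfold swim_angle; ring).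
  set (y := swim_coord s 0 / sin s ^ 2).
  replace (cos (PI / 2 + atan y)) with (- sin (atan y)) by (rewrite sin_cos; ring).
  rewrite sin_atan.
  assert (Hk2 : 0 < sin s ^ 2) by (apply pow_lt; lra).
  assert (Hy : 0 < sqrt (1 + y²)).
  { apply sqrt_lt_R0. pose proof (Rle_0_sqr y). lra. }
  assert (Hr : swim_radius s 0 = sin s ^ 2 * sqrt (1 + y²)).
  { unfold swim_radius. rewrite <- (sqrt_square (sin s ^ 2)) at 1 by lra.
    rewrite <- sqrt_mult_alt by nra. f_equal. unfold y, Rsqr. field. lra. }
  rewrite Hr.
  replace (mu * (sin s ^ 2 * sqrt (1 + y²)) * - (y / sqrt (1 + y²)))
    with (- (mu * (sin s ^ 2 * y))) by (field; lra).
  unfold y, swim_coord. field. lra.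
Qed.

Lemma tributary_saddle_point (mu s : R) :
  0 < mu < 1 -> 0 < s < PI / 2 ->
  saddle_point mu (tributary_path mu s 0) (opposition mu (sin s)) (pursuit s)
    (entry_time s + (PI / 2 - s)).
Proof.
  intros Hmu Hs. pose proof PI_RGT_0 as HPI. pose proof PI2_1 as HPI2.
  destruct (sin_cos_acute s Hs) as [Hk _].
  pose proof (entry_time_bounds s Hs) as [He _].
  assert (Hy0 : tributary_path mu s 0 = (mu * swim_radius s 0, swim_angle s 0))
    by (apply tributary_path_before; lra).
  split; [apply opposition_admissible; lra|].
  split; [apply pursuit_admissible; lra|].
  split; [|split].
  - exists (tributary_path mu s). split; [reflexivity|]. now apply tributary_play.
  - intros x psi omega Hx Hm Hf. rewrite Hy0 in Hx.
    destruct (opposition_reaches_antipodal mu s _ x psi omega (proj1 Hmu) Hs Hm Hf Hx)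
      as [t1 [Ht1 [Hr1 [Hc1 Hin1]]]]; [lra|].
    pose proof (swim_arrival s t1 Hs Ht1) as Harr.
    assert (Hacos : fst (x t1) / mu = swim_radius s t1) by (rewrite Hr1; field; lra).
    destruct (opposition_reaches_E_from_antipodal mu (sin s)
      (entry_time s + (PI / 2 - s)) t1 x psi omega) as [t [Ht [HE Hin]]]; auto; try lra.
    + apply Hin1. lra.
    + rewrite Hacos. lra.
    + rewrite Hacos in Ht. exists t. split; [lra|]. split; [assumption|].
      intros u Hu. apply in_game_inside; [lra|].
      destruct (Rle_dec u t1).
      * assert (0 < fst (x u) <= mu) by (apply Hin1; lra). lra.
      * apply Hin. lra.
  - intros t x psi omega Hx Hm Hf _ HE. apply Rnot_lt_le. intros Hlt.
    pose proof Hm as [Ht _]. rewrite Hy0 in Hx.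
    pose proof (swim_front_start mu s Hs) as Hstart.
    assert (Hstart' : fst (x 0) * (cos (snd (x 0)) * cos (s + entry_time s)
       + Rabs (sin (snd (x 0))) * sin (s + entry_time s)) =
       mu * entry_time s - mu * sin s * cos s) by (rewrite Hx; exact Hstart).
    destruct (Rle_dec t (entry_time s)).
    + apply (not_at_E_before mu s t (entry_time s) t s x psi omega); auto; lra.
    + apply (not_at_E_after mu s t (entry_time s) t s x psi omega); auto; try lra.
      pose proof (pursuit_front_before mu s t (entry_time s) (entry_time s) s x psi omega)
        as Hfront.
      cbv beta zeta in Hfront.
      rewrite Rminus_0_r, Hstart', Rminus_diag, Rplus_0_r in Hfront.
      assert (Hs' : 0 < s <= s) by lra.
      specialize (Hfront (proj1 Hmu) Hs' Hm Hf). lra.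
Qed.

Lemma tributary_exists (mu s : R) :
  0 < mu < 1 -> 0 < s < PI / 2 ->
  tributary mu (FL mu) (fun t => (mu * sin t, PI)) s.
Proof.
  intros Hmu Hs. pose proof PI_RGT_0 as HPI.
  destruct (sin_cos_acute s Hs) as [Hk Hc].
  pose proof (entry_time_bounds s Hs) as [He _].
  exists (opposition mu (sin s)), (pursuit s), (entry_time s + (PI / 2 - s)),
    (entry_time s), (tributary_path mu s).
  split; [split; [now apply tributary_saddle_point|split; [now apply tributary_play|]]|].
  { intros t Ht. destruct (Rle_dec t (entry_time s)).
    - rewrite tributary_path_before by assumption. simpl.
      assert (PI / 2 + s <= swim_angle s t <= PI) by (apply swim_angle_range; lra). lra.
    - rewrite tributary_path_after by lra. simpl. lra. }
  split; [lra|]. split; [|split].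
  - intros t Ht [_ E]. rewrite tributary_path_before in E by lra. simpl in E.
    assert (swim_angle s t < PI) by (apply swim_angle_lt; lra). lra.
  - intros t Ht. split.
    + apply tributary_fst_bounds; lra.
    + rewrite tributary_path_after by lra. reflexivity.
  - split.
    + rewrite tributary_path_after by lra. do 2 f_equal. f_equal. ring.
    + exists (mu * cos s, 0), 1. simpl.
      split; [|split; [lra|split; [|split; [|split]]]].
      * intros E. injection E as E. assert (0 < mu * cos s) by (apply Rmult_lt_0_compat; lra).
        lra.
      * auto_derive; [trivial|ring].
      * auto_derive; trivial.
      * simpl. apply (left_quotient (fun u => mu * swim_radius s u)).
        -- replace (1 * (mu * cos s))
             with (mu * (swim_coord s (entry_time s) / swim_radius s (entry_time s))).
           ++ apply (is_derive_scal (swim_radius s)). now apply is_derive_swim_radius.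
           ++ rewrite swim_radius_entry by assumption. unfold swim_coord. field. lra.
        -- intros u Hu. now rewrite tributary_path_before by assumption.
      * simpl. apply (left_quotient (swim_angle s)).
        -- replace (1 * 0) with (sin s ^ 2 /
             (swim_radius s (entry_time s) * swim_radius s (entry_time s)) - 1).
           ++ now apply is_derive_swim_angle.
           ++ rewrite swim_radius_entry by assumption. field. lra.
        -- intros u Hu. now rewrite tributary_path_before by assumption.
Qed.

Theorem proposition1 (mu_crit mu : R) (Hcrit : critical_speed mu_crit)
    (Hmu : mu_crit < mu < 1) :
  exists (sigma : strategy_L) (tau : strategy_M),
    focal_line mu sigma tau (FL mu) /\
    forall r : R, 0 < r <= mu ->
      let omega_FL := tau (r, PI) in
      let psi_FL := sigma (r, PI) omega_FL in
      theta_rate mu r psi_FL omega_FL = 0 /\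
      sin psi_FL = r / mu /\
      omega_FL = 1.
Proof.
  pose proof PI_RGT_0 as HPI.
  assert (H : 0 < mu < 1) by (destruct Hcrit as [Hc _]; lra).
  assert (Heta : 0 < PI / 2 <= PI / 2) by lra.
  exists (opposition mu 0), (pursuit (PI / 2)). split.
  - exists (PI / 2), (fun t => (mu * sin t, PI)). split; [lra|]. split; [|split].
    + intros [r th]. unfold FL; simpl. split.
      * intros [Hr ->].
        assert (Hy : 0 < r / mu <= 1).
        { split; [apply Rdiv_lt_0_compat; lra|]. apply (Rdiv_le_1 r); lra. }
        exists (asin (r / mu)). split.
        -- split; [|apply asin_bound].
           rewrite <- asin_0. apply Rnot_le_lt. intros Hle.
           assert (sin (asin (r / mu)) <= sin (asin 0)).
           { pose proof (asin_bound (r / mu)). pose proof (asin_bound 0).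
             apply sin_incr_1; lra. }
           rewrite !sin_asin in H0; lra.
        -- rewrite sin_asin by lra. f_equal. field. lra.
      * intros [t [Ht E]]. injection E as <- <-. split; [|reflexivity].
        apply (focal_dynamics mu 0); lra.
    + intros s Hs. split; [|split].
      * rewrite Rplus_0_r. now apply focal_saddle_point.
      * now apply focal_play.
      * intros t _. simpl. lra.
    + intros s Hs. now apply tributary_exists.
  - intros r Hr. cbv zeta.
    rewrite (pursuit_at_PI (PI / 2) r PI Heta cos_PI).
    rewrite opposition_antipodal by (apply cos_PI || lra).
    assert (Hy : 0 < r / mu <= 1).
    { split; [apply Rdiv_lt_0_compat; lra|]. apply (Rdiv_le_1 r); lra. }
    rewrite Rmult_1_r. unfold theta_rate. rewrite sin_asin by lra.
    split; [field; lra|]. split; reflexivity.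
Qed.
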